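(* There exists a constant $C>0$ such that for every graph $H$ and every integer $n\geq C\,|H|\log^4\chi(H)$, the cycle $C_n$ is $H$-good, i.e. \[R(C_n,H)=(\chi(H)-1)(n-1)+\sigma(H).\]
   Context: For graphs $F,H$, the Ramsey number $R(F,H)$ is the minimum $N$ such that every $N$-vertex graph $G$ either contains a copy of $F$ or its complement $\overline{G}$ contains a copy of $H$. $C_n$ denotes the cycle on $n$ vertices, $|H|$ is the number of vertices of $H$, and $\chi(H)$ is its chromatic number. $\sigma(H)$ is the minimum possible size of a colour class in a proper colouring of $H$ with $\chi(H)$ colours. A connected graph $F$ is called $H$-good if $R(F,H)=(\chi(H)-1)(|F|-1)+\sigma(H)$. Logarithms are natural. *)

(* Defs.v *)
From Stdlib Require Import Reals.
From mathcomp Require Import all_boot.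
Set Implicit Arguments. Unset Strict Implicit. Unset Printing Implicit Defensive.

Definition simple_graph (V : finType) (e : rel V) : Prop :=
  symmetric e /\ irreflexive e.

Definition contains (U : finType) (eF : rel U) (W : finType) (eG : rel W) : Prop :=
  exists f : U -> W, injective f /\ forall x y, eF x y -> eG (f x) (f y).

Definition compl (W : finType) (eG : rel W) : rel W :=
  fun x y => (x != y) && ~~ eG x y.

Definition ramsey_prop (U : finType) (eF : rel U) (V : finType) (eH : rel V)
  (N : nat) : Prop :=
  forall eG : rel 'I_N, simple_graph eG ->
    contains eF eG \/ contains eH (compl eG).

Definition is_ramsey_number (U : finType) (eF : rel U) (V : finType) (eH : rel V)
  (N : nat) : Prop :=
  ramsey_prop eF eH N /\ forall M, ramsey_prop eF eH M -> N <= M.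

(* The cycle C_n on vertex set 'I_n (a genuine cycle for n >= 3). *)
Definition cycle_rel (n : nat) : rel 'I_n :=
  fun i j => (nat_of_ord j == (i.+1) %% n) || (nat_of_ord i == (j.+1) %% n).

Arguments cycle_rel n : clear implicits.

Definition proper (V : finType) (e : rel V) (k : nat) (f : {ffun V -> 'I_k}) : bool :=
  [forall x, forall y, e x y ==> (f x != f y)].

Definition colorable (V : finType) (e : rel V) (k : nat) : bool :=
  [exists f : {ffun V -> 'I_k}, proper e f].

(* Chromatic number: least k such that e is k-colourable (k = #|V| always works). *)
Definition chi (V : finType) (e : rel V) : nat :=
  \big[minn/#|V|]_(k < #|V|.+1 | colorable e k) (k : nat).

Definition colour_sigma (V : finType) (e : rel V) : nat :=
  \big[minn/#|V|]_(f : {ffun V -> 'I_(chi e)} | proper e f)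
     \big[minn/#|V|]_(i : 'I_(chi e)) #|[set x | f x == i]|.

(* Main.v *)
(* Write k = chi H, let M >= |H| be of order n / log^4 k, and call a family of
   pairwise disjoint and pairwise non-adjacent sets of vertices anticomplete.  H embeds in
   the complement of G as soon as G contains an anticomplete family of the sizes of the
   colour classes of H; in particular G has no anticomplete family of k sets of size M.
   Let f(W) be the largest size of an anticomplete family of M-sets in W.  Among the sets W
   with |W| >= psi(f(W)), where psi(w) = w (n0 + dl log w) and n0 is slightly less than n,
   take one with w = f(W) minimal.  The superadditivity of psi makes W an expander: deleting
   S from W leaves two non-adjacent parts only if |S| is at least 1 / O(log k) times the
   smaller part.

   If w = 1, any two M-subsets of W are joined by an edge, and depth-first search gives a
   path of almost n vertices in W.  Posa rotations restricted to an initial and a final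
   segment of the path make many vertices possible ends, independently at both sides.  By
   induction the vertices off the path contain an anticomplete family for the first k - 1
   classes.  Either one of its vertices can be inserted into the initial segment, which
   lengthens the path by exactly one, or submodularity shows that many of the possible ends
   have no neighbour in the family, which completes it.  At length n an edge between the
   two sets of possible ends closes the path to a cycle.

   If w >= 2, remove from W three disjoint hubs (connected sets of small radius that
   dominate almost all of W) and then, in a breadth-first search of the rest, find a layer
   containing a path Q.  Two long paths, the hubs, Q and a shortest path back to the root
   form a cycle, and its length is adjusted to n by cutting Q short, since all vertices of Q
   are at the same distance from the root. *)

Require Import Defs.
From Stdlib Require Import Reals.
From mathcomp Require Import all_boot.
From mathcomp Require Import boolp zify.
From Stdlib Require Import Lra.
Set Implicit Arguments. Unset Strict Implicit. Unset Printing Implicit Defensive.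

(* Hypotheses outside linear arithmetic are cleared because they make [lia] very slow. *)
Ltac alia :=
  repeat match goal with H : ?t |- _ =>
    lazymatch t with
    | is_true (leq _ _) => fail
    | is_true (leq _ _ && leq _ _) => fail
    | @eq bool (leq _ _) _ => fail
    | @eq ?A _ _ => tryif unify A nat then fail else clear H
    | is_true (~~ (@eq_op ?A _ _)) => tryif unify (Equality.sort A) nat then fail else clear H
    | is_true (@eq_op ?A _ _) => tryif unify (Equality.sort A) nat then fail else clear H
    | nat => fail
    | _ => clear H
    end
  end;
  repeat match goal with
  | |- context [@size ?B ?s] => let A := eval hnf in B in
      tryif constr_eq A B then fail else change (@size B s) with (@size A s)
  | H : context [@size ?B ?s] |- _ => let A := eval hnf in B in
      tryif constr_eq A B then fail else change (@size B s) with (@size A s) in H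
  end; lia.

(** * Neighbourhoods, anticomplete families, paths and depth-first search *)

Section Graph.
Variables (T : finType) (e : rel T).
Implicit Types (A B X Y : {set T}) (p q : seq T) (ms : seq nat).

Definition nbh A : {set T} := [set y | [exists x in A, e x y]].
Definition clos A : {set T} := A :|: nbh A.

Lemma nbhP A y : reflect (exists2 x, x \in A & e x y) (y \in nbh A).
Proof. by rewrite inE; apply: exists_inP. Qed.

Lemma nbhS A B : A \subset B -> nbh A \subset nbh B.
Proof. by move=> sAB; apply/subsetP=> y /nbhP[x /(subsetP sAB) xB exy]; apply/nbhP; exists x. Qed.

Lemma closS A B : A \subset B -> clos A \subset clos B.
Proof. by move=> sAB; apply: setUSS => //; apply: nbhS. Qed.

Lemma nbhU A B : nbh (A :|: B) = nbh A :|: nbh B.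
Proof.
apply/setP=> y; rewrite in_setU; apply/nbhP/orP => [[x]|].
  by rewrite in_setU => /orP[xA|xB] exy; [left|right]; apply/nbhP; exists x.
by case=> /nbhP[x xA exy]; exists x; rewrite // in_setU xA ?orbT.
Qed.

Lemma sub_clos A : A \subset clos A.
Proof. exact: subsetUl. Qed.

Lemma exists_subset_card A k : k <= #|A| -> exists2 B : {set T}, B \subset A & #|B| = k.
Proof.
move=> kA; exists [set x in take k (enum A)].
  by apply/subsetP=> x; rewrite inE => /mem_take; rewrite mem_enum.
rewrite cardsE; have /card_uniqP-> : uniq (take k (enum A)) by rewrite take_uniq ?enum_uniq.
by rewrite size_takel // -cardE.
Qed.

(** Anticomplete families with sizes [ms]: once the first set is chosen, the others must avoid its
    closed neighbourhood. The recursive form lets inductions peel off one set at a time. *)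
Fixpoint fam ms X : bool :=
  if ms is a :: ms' then
    [exists A : {set T}, [&& A \subset X, #|A| == a & fam ms' (X :\: clos A)]]
  else true.

Lemma fam_consP a ms X :
  reflect (exists A : {set T}, [/\ A \subset X, #|A| = a & fam ms (X :\: clos A)])
          (fam (a :: ms) X).
Proof.
apply: (iffP existsP) => -[A].
  by case/and3P=> sA /eqP cA fA; exists A.
by case=> sA cA fA; exists A; rewrite sA cA eqxx.
Qed.

Lemma famS ms X Y : X \subset Y -> fam ms X -> fam ms Y.
Proof.
elim: ms X Y => [|a ms IH] X Y //= sXY /fam_consP[A [sA cA fA]].
apply/fam_consP; exists A; split=> //; first exact: subset_trans sXY.
by apply: IH fA; apply: setSD.
Qed.

(** Sets chosen inside [X] have their closed neighbourhoods inside [clos X], so they use up no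
    vertex of [Y]. *)
Lemma fam_cat ms1 ms2 X Y : [disjoint clos X & Y] ->
  fam ms1 X -> fam ms2 Y -> fam (ms1 ++ ms2) (X :|: Y).
Proof.
elim: ms1 X => [|a ms1 IH] X dXY //=.
  by move=> _; apply: famS; apply: subsetUr.
move=> /fam_consP[A [sA cA fA]] fY; apply/fam_consP; exists A; split=> //.
  by apply: subset_trans sA (subsetUl _ _).
have sD : [disjoint clos (X :\: clos A) & Y].
  by apply: disjointWl dXY; apply: closS; apply: subsetDl.
apply: famS (IH _ sD fA fY); rewrite setDUl setUS //.
apply/subsetP=> y yY; rewrite inE yY andbT; apply: contraTN yY => yA.
by rewrite (disjointFr dXY) //; apply: (subsetP (closS sA)).
Qed.

Lemma fam_le ms (M : nat) X : all (fun a => a <= M) ms ->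
  fam (nseq (size ms) M) X -> fam ms X.
Proof.
elim: ms X => [|a ms IH] X //= /andP[aM allM] /fam_consP[A [sA cA fA]].
have [B sB cB] : exists2 B : {set T}, B \subset A & #|B| = a.
  by apply: exists_subset_card; rewrite cA.
apply/fam_consP; exists B; split=> //; first exact: subset_trans sA.
by apply: IH => //; apply: famS fA; apply: setDS; apply: closS.
Qed.

Lemma fam_nseq_le M i j X : i <= j -> fam (nseq j M) X -> fam (nseq i M) X.
Proof.
elim: i j X => [|i IH] [|j] X //= ij /fam_consP[A [sA cA fA]].
by apply/fam_consP; exists A; split=> //; apply: IH fA.
Qed.

Lemma fam_nseq_card M j X : fam (nseq j M) X -> j * M <= #|X|.
Proof.
elim: j X => [|j IH] X //= /fam_consP[A [sA cA /IH cX]].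
rewrite mulSn -(cardsID A X) (setIidPr sA) cA leq_add2l.
by apply: leq_trans cX _; apply: subset_leq_card; apply: setDS; apply: sub_clos.
Qed.

Definition gpath X p := [&& uniq p, sorted e p & all (fun x => x \in X) p].

Lemma gpathS X Y p : X \subset Y -> gpath X p -> gpath Y p.
Proof.
move=> sXY /and3P[up sp ap]; apply/and3P; split=> //.
by apply/allP=> x /(allP ap); apply: (subsetP sXY).
Qed.

Lemma gpath_drop X p k : gpath X p -> gpath X (drop k p).
Proof.
case/and3P=> up sp ap; apply/and3P; split; first by rewrite drop_uniq.
  exact: drop_sorted.
by apply/allP=> x /mem_drop; apply: (allP ap).
Qed.

Lemma gpath_take X p k : gpath X p -> gpath X (take k p).
Proof.
case/and3P=> up sp ap; apply/and3P; split; first by rewrite take_uniq.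
  exact: take_sorted.
by apply/allP=> x /mem_take; apply: (allP ap).
Qed.

Lemma gpath_exact X p k : gpath X p -> k <= size p -> exists2 q, gpath X q & size q = k.
Proof. by move=> gp kp; exists (take k p); rewrite ?size_takel // gpath_take. Qed.

Hypothesis e_sym : symmetric e.

Lemma clos_disjointC X Y : [disjoint clos X & Y] = [disjoint X & clos Y].
Proof.
have aux (U V : {set T}) : [disjoint clos U & V] -> [disjoint U & clos V].
  move=> dUV; apply/pred0P=> x /=; apply: contraTF dUV => /andP[xU].
  rewrite inE => /orP[xV|/nbhP[y yV eyx]]; apply/pred0Pn.
    by exists x; rewrite /= xV (subsetP (sub_clos U)).
  exists y; rewrite /= yV andbT inE; apply/orP; right.
  by apply/nbhP; exists x; rewrite // e_sym.
by apply/idP/idP => [/aux //|]; rewrite disjoint_sym => /aux; rewrite disjoint_sym.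
Qed.

(* Depth-first search: [D] is the set of finished vertices and [st] the stack. *)
Lemma dfs X s d : d <= #|X| -> (forall p, gpath X p -> size p < s) ->
  exists D U : {set T}, [/\ D \subset X, U \subset X, #|D| = d,
    [disjoint clos D & U] & #|X| <= d + #|U| + s.-1].
Proof.
move=> dX noP.
pose inv (D : {set T}) st := [/\ D \subset X, gpath X st, [disjoint D & [set x in st]],
  #|D| <= d & [disjoint clos D & X :\: D :\: [set x in st]]].
(* The potential counts an unvisited vertex twice and a stack vertex once, so both a push and a pop
   lower it. *)
suff H k D st : inv D st -> 2 * #|X :\: D :\: [set x in st]| + size st <= k ->
    exists D U : {set T}, [/\ D \subset X, U \subset X, #|D| = d,
    [disjoint clos D & U] & #|X| <= d + #|U| + s.-1].
  apply: (H _ set0 [::]) (leqnn _); split; rewrite ?sub0set ?cards0 //.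
    by rewrite disjoints_subset sub0set.
  rewrite disjoints_subset; apply/subsetP=> x; rewrite !inE /=.
  by case/existsP=> y; rewrite inE.
elim: k D st => [|k IH] D st [sD gst dDs cD dU] le_k; last first.
  have cX : #|X| = #|D| + size st + #|X :\: D :\: [set x in st]|.
    have stX : [set x in st] \subset X.
      by apply/subsetP=> x; rewrite inE; case/and3P: gst => _ _ /allP; apply.
    rewrite -{1}(cardsID D X) (setIidPr sD) -(cardsID [set x in st] (X :\: D)) addnA.
    congr (_ + _ + _); have /setIidPr-> : [set x in st] \subset X :\: D.
      by rewrite subsetD stX disjoint_sym.
    by rewrite cardsE; apply/card_uniqP; case/and3P: gst.
  (* The search stops once [d] vertices are finished. The stack is then a path, hence has at most
     [s.-1] vertices. *)
  have [cDd|/negbTE ncD] := boolP (#|D| == d).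
    exists D, (X :\: D :\: [set x in st]); split=> //.
    - exact: subset_trans (subsetDl _ _) (subsetDl _ _).
    - exact/eqP.
    have := noP _ gst; rewrite cX (eqP cDd); lia.
  case: st gst dDs dU cX le_k => [|h st] gst dDs dU cX le_k.
    set U := X :\: D :\: _ in dU le_k cX => /=.
    have [u uU] : exists u, u \in U.
      by apply/set0Pn; rewrite -card_gt0; move: dX cX ncD cD; rewrite /=; lia.
    have [uX uD] : u \in X /\ u \notin D by move: uU; rewrite !inE /= => /andP[].
    apply: (IH D [:: u]).
      split=> //; first by rewrite /gpath /= uX.
        by rewrite disjoint_sym; apply/pred0P=> x /=; rewrite !inE; case: eqP => // ->; apply/negbTE.
      apply: disjointWr dU; apply/subsetP=> x; rewrite !inE => /andP[_ ->].
      by rewrite andbT.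
    have : X :\: D :\: [set x in [:: u]] \proper U.
      apply/properP; split; last by exists u => //; rewrite !inE eqxx.
      by apply/subsetP=> x; rewrite !inE => /andP[_ ->]; rewrite andbT.
    move/proper_card; move: le_k => /=; lia.
  set U := X :\: D :\: _ in dU le_k cX => /=.
  have [/existsP[u /andP[uU ehu]]|/existsPn noU] := boolP [exists u, (u \in U) && e h u].
    have [uX uD ust] : [/\ u \in X, u \notin D & u \notin h :: st].
      by move: uU; rewrite !inE /= => /and3P[].
    apply: (IH D [:: u, h & st]).
      split=> //.
      - case/and3P: gst => us ss als; apply/and3P; split.
        + by rewrite cons_uniq ust.
        + by rewrite /= e_sym ehu.
        + by rewrite /= uX.
      - apply/pred0P=> x /=; rewrite !inE; case xD: (x \in D) => //=.
        case: eqP => [xu|_ /=]; first by rewrite -xu xD in uD.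
        by have := disjointFr dDs xD; rewrite !inE.
      apply: disjointWr dU; apply/subsetP=> x; rewrite !inE => /andP[+ ->].
      by rewrite andbT !negb_or => /andP[].
    have : X :\: D :\: [set x in [:: u, h & st]] \proper U.
      apply/properP; split; last by exists u => //; rewrite !inE eqxx.
      apply/subsetP=> x; rewrite !inE => /andP[+ ->].
      by rewrite andbT !negb_or => /andP[].
    move/proper_card; move: le_k => /=; lia.
  have hX : h \in X by case/and3P: gst => _ _ /= /andP[].
  have hD : h \notin D by rewrite disjoint_sym in dDs; rewrite (disjointFr dDs) // !inE eqxx.
  have hst : h \notin st by case/and3P: gst => /= /andP[].
  have eU : X :\: (h |: D) :\: [set x in st] = U.
    apply/setP=> x; rewrite !inE !negb_or; case: (x == h); case: (x \in st) => //=; by rewrite ?andbF.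
  apply: (IH (h |: D) st); last by rewrite eU; move: le_k => /=; lia.
  split.
  - by apply/subsetP=> x; rewrite !inE => /orP[/eqP->|/(subsetP sD)].
  - by have := gpath_drop 1 gst; rewrite /= drop0.
  - apply/pred0P=> x /=; rewrite !inE; case: eqP => [->|_] /=; first exact/negbTE.
    by case xD: (x \in D) => //=; have := disjointFr dDs xD; rewrite !inE => /norP[_ /negbTE].
  - by rewrite cardsU1 hD; move: cD ncD; lia.
  rewrite eU; apply/pred0P=> x /=; apply/negbTE/negP=> /andP[+ xU].
  rewrite !inE => /orP[/orP[/eqP xh|xD]|/existsP[y /andP[+ eyx]]].
  - by move: xU; rewrite xh !inE eqxx.
  - by have := disjointFl dU xU; rewrite !inE xD.
  rewrite !inE => /orP[/eqP yh|yD]; first by have := noU x; rewrite xU -yh eyx.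
  have := disjointFl dU xU; rewrite !inE => /norP[_ /existsPn/(_ y)].
  by rewrite yD eyx.
move: le_k; rewrite leqn0 addn_eq0 muln_eq0 /= cards_eq0 => /andP[/eqP U0 /nilP st0].
have XD : X = D.
  apply/eqP; rewrite eqEsubset sD andbT; apply/subsetP=> x xX; apply/negPn/negP=> xD.
  by have := in_set0 x; rewrite -U0 st0 !inE xD xX.
exists D, set0; split; rewrite ?sub0set //.
- by apply/eqP; rewrite eqn_leq cD -{1}XD dX.
- by rewrite disjoints_subset setC0 subsetT.
- by rewrite XD; move: cD; lia.
Qed.

(** If there is no long path, a search stopped at [M] finished vertices uses up fewer than [s + M]
    vertices and leaves a remainder not adjacent to these [M]. After [j] rounds, [M] vertices are
    left for the last set. *)
Lemma long_path_or_fam X s M j : 0 < s -> j * (s + M) + M <= #|X| ->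
  (exists2 p, gpath X p & size p = s) \/ fam (nseq j.+1 M) X.
Proof.
move=> s0 cX; have [[p gp sp]|noP] := pselect (exists2 p, gpath X p & s <= size p).
  by left; apply: gpath_exact gp sp.
right; have {}noP p : gpath X p -> size p < s.
  by move=> gp; rewrite ltnNge; apply/negP=> sp; apply: noP; exists p.
elim: j X cX noP => [|j IH] X cX noP.
  rewrite mul0n add0n in cX; have [B sB cB] := exists_subset_card cX.
  by apply/fam_consP; exists B; split.
have [D [U [sD sU cD dDU cU]]] : exists D U : {set T}, [/\ D \subset X, U \subset X, #|D| = M,
    [disjoint clos D & U] & #|X| <= M + #|U| + s.-1].
  by apply: dfs => //; move: cX; lia.
apply/fam_consP; exists D; split=> //.
apply: famS (IH U _ _).
- by rewrite subsetD sU disjoint_sym.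
- by move: cX cU; rewrite mulSn; lia.
by move=> p gp; apply: noP; apply: gpathS gp.
Qed.

End Graph.

(** * Rotations of paths *)

Section Rotations.
Variables (T : finType) (e : rel T).
Hypotheses (e_sym : symmetric e) (e_irr : irreflexive e).
Implicit Types (A B X Y : {set T}) (p q : seq T).

Lemma sorted_catE x0 p q : sorted e (p ++ q) =
  [&& sorted e p, sorted e q & [|| p == [::], q == [::] | e (last x0 p) (head x0 q)]].
Proof.
case: p => [|x p]; first by rewrite /= andbT.
case: q => [|y q] /=; first by rewrite cats0 !andbT.
by rewrite cat_path /=; case: (path e x p); case: (e _ _); case: (path e y q).
Qed.

Lemma sorted_rev p : sorted e (rev p) = sorted e p.
Proof. by rewrite rev_sorted; apply: eq_sorted => x y; rewrite e_sym. Qed.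

(** The Posa rotation with pivot at position [c], meant for a pivot adjacent to the head: the vertex
    before the pivot becomes the head, and the other end of the path stays fixed. *)
Definition rotated (c : nat) q := rev (take c q) ++ drop c q.

Lemma perm_rotated c q : perm_eq (rotated c q) q.
Proof. by rewrite /rotated -{3}(cat_take_drop c q) perm_cat2r perm_rev. Qed.

Lemma nth_rotated x0 c q j : c <= size q ->
  nth x0 (rotated c q) j = if j < c then nth x0 q (c - j.+1) else nth x0 q j.
Proof.
move=> cq; rewrite /rotated nth_cat size_rev size_takel //.
case: ifP => jc; last by rewrite nth_drop subnKC // leqNgt jc.
by rewrite nth_rev size_takel // nth_take //; alia.
Qed.

Lemma size_rotated c q : size (rotated c q) = size q.
Proof. exact/perm_size/perm_rotated. Qed.

Section Posa.
Variables (x0 : T) (L : {set T}).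

(** Only pivots in [L] are allowed; this later keeps the heads out of a set with no neighbour in
    [L]. *)
Inductive reach p : seq T -> Prop :=
| reach0 : reach p p
| reachS q c : reach p q -> 0 < c < size q -> nth x0 q c \in L ->
    e (nth x0 q 0) (nth x0 q c) -> reach p (rotated c q).

Definition heads p : {set T} := [set h | `[< exists2 q, reach p q & nth x0 q 0 = h >]].

Lemma headsP p h : reflect (exists2 q, reach p q & nth x0 q 0 = h) (h \in heads p).
Proof. by rewrite inE; apply: asboolP. Qed.

Lemma reach_perm p q : reach p q -> perm_eq q p.
Proof. by elim=> // {}q c _ + _ _ _; apply: perm_trans; apply: perm_rotated. Qed.

Lemma reach_sorted p q : sorted e p -> reach p q -> sorted e q.
Proof.
move=> sp; elim=> // {}q c _ sq /andP[c0 cq] _ e0.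
have := sq; rewrite -{1}(cat_take_drop c q) !(sorted_catE x0) sorted_rev.
case/and3P=> -> -> _ /=; apply/orP; right; apply/orP; right.
case: q cq c0 e0 {sq} => [|x q] //=; case: c => // c cq _ /= e0.
by rewrite rev_cons last_rcons -nth0 nth_drop addn0.
Qed.

Lemma reach_last p q : reach p q -> last x0 q = last x0 p.
Proof.
elim=> // {}q c _ <- /andP[c0 cq] _ _.
rewrite /rotated last_cat -{3}(cat_take_drop c q) last_cat.
by case E: (drop c q) => [|//]; move: cq; rewrite -subn_gt0 -size_drop E.
Qed.

Definition padj p a b := exists2 i, i.+1 < size p &
  (nth x0 p i = a /\ nth x0 p i.+1 = b) \/ (nth x0 p i = b /\ nth x0 p i.+1 = a).

(** A rotation separates only the pivot from its predecessor, and this predecessor becomes a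
    head. *)
Lemma padj_rotated p q c a b : reach p q -> reach p (rotated c q) -> 0 < c < size q ->
  a \notin heads p -> b \notin heads p -> padj q a b -> padj (rotated c q) a b.
Proof.
move=> rq rq' /andP[c0 cq] na nb [i iq ab].
have hc : nth x0 q c.-1 \in heads p.
  apply/headsP; exists (rotated c q) => //; rewrite nth_rotated ?c0; last exact: ltnW.
  by rewrite subn1.
have [ic|ci] := ltnP i.+1 c.
  exists (c - i.+2); first by rewrite size_rotated; alia.
  rewrite !nth_rotated ?(ltnW cq) //.
  have -> : c - i.+2 < c by alia.
  have -> : (c - i.+2).+1 < c by alia.
  have -> : c - (c - i.+2).+1 = i.+1 by alia.
  have -> : c - (c - i.+2).+2 = i by alia.
  by case: ab => -[]; [right|left].
have [ci'|ic'] := eqVneq i.+1 c.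
  have ei : nth x0 q i \in heads p by have -> : i = c.-1 by alia.
  by case: ab => -[E _]; move: na nb; rewrite -E ei.
exists i; first by rewrite size_rotated.
rewrite !nth_rotated ?(ltnW cq) //.
by have [-> ->] : (i < c) = false /\ (i.+1 < c) = false by split; alia.
Qed.

Lemma padj_reach p q a b : reach p q -> a \notin heads p -> b \notin heads p ->
  padj p a b -> padj q a b.
Proof.
move=> rq na nb pab; elim: rq => // {}q c rq IH cq cL e0.
by apply: (padj_rotated rq) => //; apply: reachS.
Qed.

Lemma nth_uniq_eq p i j : uniq p -> i < size p -> j < size p ->
  nth x0 p i = nth x0 p j -> i = j.
Proof. by move=> up ip jp /eqP; rewrite nth_uniq // => /eqP. Qed.

(** Let [z] be adjacent to the head of a reached path [q]. Rotating at [z] makes its predecessor on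
    [q] a head. If neither [z] nor a neighbour of [z] on [p] is a head, the neighbours on [p] are
    still next to [z] on [q] and differ from that predecessor, so all of them equal the successor of
    [z], a contradiction. *)
Lemma posa_nbr p z : uniq p -> L \subset [set x in p] ->
  z \in nbh e (heads p) -> z \in L ->
  z \in heads p \/ exists2 r, r \in heads p & padj p z r.
Proof.
move=> up sL /nbhP[r /headsP[q rq hq] erz] zL.
have [zR|zR] := boolP (z \in heads p); first by left.
right; have [//|noadj] := pselect (exists2 r, r \in heads p & padj p z r).
have pq := reach_perm rq; have uq : uniq q by rewrite (perm_uniq pq).
have zq : z \in q by rewrite (perm_mem pq); have := subsetP sL _ zL; rewrite inE.
have zp : z \in p by rewrite -(perm_mem pq).
have [c cq ec] : exists2 c, c < size q & nth x0 q c = z.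
  by exists (index z q); rewrite ?index_mem ?nth_index.
have [d dp ed] : exists2 d, d < size p & nth x0 p d = z.
  by exists (index z p); rewrite ?index_mem ?nth_index.
have spq : size q = size p by apply: perm_size.
have c0 : 0 < c.
  rewrite lt0n; apply/eqP=> c0; move: erz; rewrite -hq -ec c0; by rewrite e_irr.
have yR : nth x0 q c.-1 \in heads p.
  have rq' : reach p (rotated c q).
    by apply: reachS => //; rewrite ?c0 ?cq ?ec ?hq.
  apply/headsP; exists (rotated c q) => //; rewrite nth_rotated ?c0; last exact: ltnW.
  by rewrite subn1.
have d0 : 0 < d.
  rewrite lt0n; apply/eqP=> d0; case/negP: zR; rewrite -ed d0.
  by apply/headsP; exists p => //; apply: reach0.
have adj_in b : padj p z b -> b = nth x0 q c.-1 \/ (c.+1 < size q /\ b = nth x0 q c.+1).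
  move=> zb; have nb : b \notin heads p by apply/negP=> bR; apply: noadj; exists b.
  have [i iq [[ei1 ei2]|[ei1 ei2]]] := padj_reach rq zR nb zb.
    have ic : i = c by apply: (nth_uniq_eq uq); rewrite ?ec //; alia.
    by right; rewrite -ic -ei2.
  have ic : i.+1 = c by apply: (nth_uniq_eq uq); rewrite ?ec //; alia.
  by left; rewrite -ic.
have contra1 b : padj p z b -> b = nth x0 q c.-1 -> False.
  by move=> zb eb; apply: noadj; exists b; rewrite // eb.
have adj1 : padj p z (nth x0 p d.-1).
  by exists d.-1; [alia|right; split=> //; rewrite prednK].
case: (adj_in _ adj1) => [/(contra1 _ adj1)[]|[cq1 e1]].
(* Rotations fix the last vertex, so [z], which has a successor on [q], is not the last vertex of
   [p]. *)
have dS : d.+1 < size p.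
  rewrite ltn_neqAle dp andbT; apply/eqP=> dS.
  have : last x0 q = z by rewrite (reach_last rq) -nth_last -dS.
  rewrite -nth_last => el; suff : (size q).-1 = c by alia.
  by apply: (nth_uniq_eq uq); rewrite ?ec //; alia.
have adj2 : padj p z (nth x0 p d.+1) by exists d => //; left.
case: (adj_in _ adj2) => [/(contra1 _ adj2)[]|[_ e2]].
suff : d.-1 = d.+1 by alia.
by apply: (nth_uniq_eq up) => //; [alia|rewrite e1 e2].
Qed.

(** By [posa_nbr], a neighbour in [L] of a head is a head, or precedes or follows a head on [p];
    hence the factor 3. *)
Lemma posa p : uniq p -> L \subset [set x in p] ->
  #|nbh e (heads p) :&: L| <= 3 * #|heads p|.
Proof.
move=> up sL.
pose nxt v := nth x0 p (index v p).+1; pose prv v := nth x0 p (index v p).-1.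
have sub : nbh e (heads p) :&: L \subset heads p :|: nxt @: heads p :|: prv @: heads p.
  apply/subsetP=> z; rewrite inE => /andP[zN zL].
  have [zR|[r rR [i ip rz]]] := posa_nbr up sL zN zL; first by rewrite 2!in_setU zR.
  case: rz => -[e1 e2].
    have er : index r p = i.+1 by rewrite -e2 index_uniq.
    rewrite 2!in_setU; apply/orP; right; apply/imsetP; exists r => //.
    by rewrite /prv er.
  have er : index r p = i by rewrite -e1 index_uniq // ltnW.
  rewrite 2!in_setU; apply/orP; left; apply/orP; right; apply/imsetP; exists r => //.
  by rewrite /nxt er.
apply: leq_trans (subset_leq_card sub) _.
apply: leq_trans (leq_card_setU _ _) _; apply: leq_trans (leq_add (leq_card_setU _ _) (leqnn _)) _.
have := leq_imset_card nxt (heads p); have := leq_imset_card prv (heads p).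
by move: #|_ @: _| #|_ @: _| => a b; alia.
Qed.

Lemma heads_sub p : 0 < size p -> heads p \subset [set x in p].
Proof.
move=> p0; apply/subsetP=> h /headsP[q rq <-]; rewrite inE -(perm_mem (reach_perm rq)).
by rewrite mem_nth // (perm_size (reach_perm rq)).
Qed.

(** A new head stands just before a pivot in [L], so it has a neighbour in [L]; vertices of [Y] have
    none. *)
Lemma heads_avoid p Y : sorted e p -> nth x0 p 0 \notin Y -> [disjoint L & nbh e Y] ->
  [disjoint heads p & Y].
Proof.
move=> sp pY dLY; apply/pred0P=> h /=; apply/negbTE/negP=> /andP[/headsP[q rq <-]].
apply/negP; elim: rq => // {}q c rq _ /andP[c0 cq] cL e0.
rewrite nth_rotated ?c0; last exact: ltnW.
apply: contraL cL => yY; rewrite (disjointFl dLY) //; apply/nbhP; exists (nth x0 q (c - 1)) => //.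
have /sortedP := reach_sorted sp rq; move=> /(_ x0 (c - 1)).
by rewrite subn1 prednK //; apply.
Qed.

Lemma mem_heads p : nth x0 p 0 \in heads p.
Proof. by apply/headsP; exists p => //; apply: reach0. Qed.

End Posa.
End Rotations.

(** * Joined sets *)

Section Joined.
Variables (T : finType) (e : rel T).
Hypotheses (e_sym : symmetric e) (e_irr : irreflexive e).
Implicit Types (A B X Y Z L S Yb : {set T}) (p q : seq T).
Local Notation nbh := (nbh e).
Local Notation clos := (clos e).

Definition has_cycle n X := exists c,
  [/\ size c = n, uniq c, cycle e c & all (fun x => x \in X) c].

Lemma cycle_sorted x0 c : sorted e c -> e (last x0 c) (head x0 c) -> cycle e c.
Proof. by case: c => [|x c] //= pc exc; rewrite rcons_path pc. Qed.

Lemma reach_cat x0 L p q rest : 0 < size p -> reach e x0 L p q ->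
  sorted e (p ++ rest) -> sorted e (q ++ rest).
Proof.
move=> p0 rq; rewrite !(sorted_catE e x0) => /and3P[sp -> lp].
rewrite (reach_sorted e_sym sp rq) (reach_last rq) /=.
have sz := perm_size (reach_perm rq).
by case: q rq sz => [|y q]; case: p p0 sp lp.
Qed.

Lemma fam_union ms X : fam e ms X -> exists A, [/\ A \subset X, #|A| = sumn ms & fam e ms A].
Proof.
elim: ms X => [|a ms IH] X /=; first by exists set0; rewrite sub0set cards0.
case/fam_consP=> B [sB cB /IH[A [sA cA fA]]].
have [sAX dAB] : A \subset X /\ [disjoint A & clos B].
  by move: sA; rewrite subsetD => /andP[].
exists (B :|: A); split.
- by rewrite subUset sB.
- rewrite cardsU cB cA; suff -> : B :&: A = set0 by rewrite cards0 subn0.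
  apply/eqP; rewrite setI_eq0; rewrite disjoint_sym; apply: disjointWr dAB; exact: sub_clos.
apply/fam_consP; exists B; split=> //; first exact: subsetUl.
by apply: famS fA; rewrite subsetD subsetUr.
Qed.

Variables (M : nat) (W : {set T}).
Hypothesis M_gt0 : 0 < M.
Hypothesis joinedW : ~~ fam e (nseq 2 M) W.

Lemma joined_disjoint A B : A \subset W -> B \subset W -> M <= #|A| -> M <= #|B| ->
  ~~ [disjoint clos A & B].
Proof.
move=> sA sB cA cB; apply: contra joinedW => dAB.
apply: famS (fam_cat (ms1 := [:: M]) (ms2 := [:: M]) dAB _ _); first by rewrite subUset sA.
  by have [C sC cC] := exists_subset_card cA; apply/fam_consP; exists C.
by have [C sC cC] := exists_subset_card cB; apply/fam_consP; exists C.
Qed.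

Lemma joined_edge A B : A \subset W -> B \subset W -> M <= #|A| -> M <= #|B| ->
  [disjoint A & B] -> exists a b, [/\ a \in A, b \in B & e a b].
Proof.
move=> sA sB cA cB dAB; have /pred0Pn[b /andP[]] := joined_disjoint sA sB cA cB.
rewrite /= in_setU => /orP[bA|/nbhP[a aA eab]] bB; last by exists a, b.
by have := disjointFr dAB bA; rewrite bB.
Qed.

(** Fix [M] vertices of [Y]. Fewer than [M] vertices of [L] lie outside their closed neighbourhood,
    and the fixed vertices themselves account for the other [M]. *)
Lemma joined_nbh Y L : Y \subset W -> L \subset W -> M <= #|Y| -> #|L| <= #|nbh Y :&: L| + M.*2.
Proof.
move=> sY sL cY; have [C sC cC] := exists_subset_card cY.
rewrite -(cardsID (nbh Y) L) setIC leq_add2l.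
have sB : L :\: clos C \subset W by apply: subset_trans (subsetDl _ _) sL.
have sCW : C \subset W by apply: subset_trans sY.
have small : #|L :\: clos C| < M.
  rewrite ltnNge; apply/negP=> cB.
  have := joined_disjoint sCW sB; rewrite cC leqnn cB => /(_ isT isT)/negP; apply.
  by rewrite disjoint_sym disjoints_subset; apply/subsetP=> x; rewrite !inE => /andP[].
have sub : L :\: nbh Y \subset (L :\: clos C) :|: C.
  apply/subsetP=> x; rewrite !inE; case: (x \in C); rewrite ?orbT //= orbF => /andP[xY ->].
  rewrite andbT; apply: contra xY => /existsP[y /andP[yC eyx]].
  by apply/existsP; exists y; rewrite (subsetP sC).
apply: leq_trans (subset_leq_card sub) _; apply: leq_trans (leq_card_setU _ _) _.
by rewrite cC -addnn leq_add2r ltnW.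
Qed.

(** The factor 4 is chosen to exceed the 3 of Posa's lemma; [Yb] collects the exceptional
    vertices. *)
Definition expanding y0 L Yb S := forall Y, Y \subset S :\: Yb -> #|Y| <= y0 ->
  4 * #|Y| <= #|nbh Y :&: L|.

(** A path ready for rotations: its head is not exceptional and [Yb] has no neighbour in [L], so all
    heads reached through [L] stay outside [Yb], where expansion holds. *)
Definition flexible x0 y0 L Yb p :=
  [/\ [/\ uniq p, sorted e p & 0 < size p],
      nth x0 p 0 \notin Yb, L \subset [set x in p] /\ L \subset W,
      [disjoint L & nbh Yb] & expanding y0 L Yb [set x in p]].

(** [Yb] is a largest badly expanding set of fewer than [M] path vertices. Its union with a further
    badly expanding [Y] expands badly too and, by maximality, has at least [M] vertices; but then it
    sees almost the whole path. As [Yb] is small, one of the first [M] vertices is outside it and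
    can serve as head. *)
Lemma flexible_init x0 y0 p : uniq p -> sorted e p -> all (fun x => x \in W) p ->
  4 * (y0 + M) + M.*2 + M < size p ->
  exists d L Yb, [/\ d <= M, flexible x0 y0 L Yb (drop d p) &
    size p <= #|L| + 5 * M].
Proof.
move=> up sp ap big.
(* The path will be cut before position [M], so [L0] survives the cut. *)
pose L0 := [set x in drop M p].
have cL0 : #|L0| = size p - M.
  by rewrite cardsE -size_drop; apply/card_uniqP; rewrite drop_uniq.
have sL0W : L0 \subset W by apply/subsetP=> x; rewrite inE => /mem_drop/(allP ap).
pose bad Y := [&& Y \subset [set x in p], #|Y| < M & #|nbh Y :&: L0| <= 4 * #|Y|].
have bad0 : bad set0.
  rewrite /bad sub0set cards0 M_gt0 /= leqn0 cards_eq0; apply/eqP/setP=> x.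
  rewrite in_setI in_set0; apply/negbTE; rewrite negb_and; apply/orP; left.
  by apply/negP=> /nbhP[y]; rewrite inE.
have [Yb /and3P[sYb cYb nYb] maxYb] := arg_maxnP (fun Y : {set T} => #|Y|) bad0.
have [d [dM dp dY]] : exists d, [/\ d < M, d < size p & nth x0 p d \notin Yb].
  apply: contrapT => no; have : [set x in take M p] \subset Yb.
    apply/subsetP=> x; rewrite inE => /(nthP x0)[i]; rewrite size_takel; last alia.
    move=> iM <-; rewrite nth_take //; apply: contrapT => /negP niY.
    by apply: no; exists i; split=> //; alia.
  move/subset_leq_card; rewrite cardsE (card_uniqP _) ?take_uniq // size_takel; last alia.
  by rewrite leqNgt cYb.
exists d, (L0 :\: nbh Yb), Yb; split; first exact: ltnW.
  split.
  - by rewrite drop_uniq // drop_sorted // size_drop subn_gt0 dp.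
  - by rewrite nth_drop addn0.
  - split; last by apply: subset_trans (subsetDl _ _) sL0W.
    apply: subset_trans (subsetDl _ _) _; apply/subsetP=> x; rewrite !inE.
    by rewrite -(subnK (ltnW dM)) -drop_drop => /mem_drop.
  - by rewrite disjoint_sym disjoints_subset; apply/subsetP=> x xN; rewrite in_setC in_setD xN.
  move=> Y sY cY; rewrite leqNgt; apply/negP=> lt4.
  have [sYp dYb] : Y \subset [set x in p] /\ [disjoint Y & Yb].
    move: sY; rewrite subsetD => /andP[sY ->]; split=> //; apply: subset_trans sY _.
    by apply/subsetP=> x; rewrite !inE => /mem_drop.
  have cZ : #|Y :|: Yb| = #|Y| + #|Yb|.
    by rewrite cardsU (_ : Y :&: Yb = set0) ?cards0 ?subn0 //; apply/eqP; rewrite setI_eq0.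
  have nZ : #|nbh (Y :|: Yb) :&: L0| <= 4 * #|Y :|: Yb|.
    have sub : nbh (Y :|: Yb) :&: L0 \subset (nbh Y :&: (L0 :\: nbh Yb)) :|: (nbh Yb :&: L0).
      apply/subsetP=> x; rewrite nbhU !in_setI !in_setU !in_setI in_setD.
      by case: (x \in nbh Y); case: (x \in nbh Yb); case: (x \in L0).
    apply: leq_trans (subset_leq_card sub) _; apply: leq_trans (leq_card_setU _ _) _.
    by rewrite cZ; alia.
  have sZp : Y :|: Yb \subset [set x in p] by rewrite subUset sYp.
  have [cZM|cZM] := ltnP #|Y :|: Yb| M.
    have /maxYb : bad (Y :|: Yb) by rewrite /bad sZp cZM.
    by rewrite cZ; alia.
  have sZW : Y :|: Yb \subset W.
    by apply: subset_trans sZp _; apply/subsetP=> x; rewrite inE => /(allP ap).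
  have := joined_nbh sZW sL0W cZM; rewrite cL0; alia.
have : #|L0| <= #|L0 :\: nbh Yb| + 4 * #|Yb|.
  by rewrite -(cardsID (nbh Yb) L0) addnC leq_add2l setIC.
by rewrite cL0; alia.
Qed.

(** The heads avoid [Yb], so with at most [y0] of them the expansion factor 4 would contradict
    Posa's 3. Hence there are more than [f + M], at most [f] of them outside [W], and the others see
    almost all of [L]. *)
Lemma flexible_heads x0 y0 L Yb p f : flexible x0 y0 L Yb p ->
  #|[set x in p] :\: L| <= f -> f + M <= y0 ->
  M <= #|heads e x0 L p :&: W| /\ #|L| <= 3 * #|heads e x0 L p| + M.*2.
Proof.
case=> [[up sp p0] hY [sLp sLW] dLY ex] cf fy.
set R := heads e x0 L p.
have sR : R \subset [set x in p] :\: Yb.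
  by rewrite subsetD heads_sub //= (heads_avoid e_sym).
have pR := posa e_irr x0 up sLp.
have Ry : y0 < #|R|.
  rewrite ltnNge; apply/negP=> cR; have := leq_trans (ex _ sR cR) pR.
  have : 0 < #|R| by apply/card_gt0P; exists (nth x0 p 0); apply: mem_heads.
  rewrite -/R; alia.
have RW : M <= #|R :&: W|.
  have : R :\: W \subset [set x in p] :\: L.
    apply/subsetP=> x; rewrite !in_setD => /andP[xW xR].
    rewrite (contra (subsetP sLW x)) //; by have := subsetP sR _ xR; rewrite in_setD => /andP[].
  by move/subset_leq_card; rewrite -(leq_add2l #|R :&: W|) cardsID; alia.
split=> //.
have := joined_nbh (subsetIr R W) sLW RW.
have : #|nbh (R :&: W) :&: L| <= #|nbh R :&: L|.
  by apply: subset_leq_card; apply: setSI; apply: nbhS; apply: subsetIl.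
by move: pR; rewrite -/R; alia.
Qed.

(** The number of neighbours in [L] is submodular. [Z] is a badly expanding set with as many
    vertices of [A] as possible. If it missed [u], a set [Y] witnessing that [u] is bad would meet
    [Z] inside [S], where sets expand; so the union of [Z] and [Y] would expand badly and contain
    more of [A]. *)
Lemma bad_union y0 L Yb S f A : L \subset W -> expanding y0 L Yb S ->
  #|S :\: W| <= f -> #|A| <= M -> [disjoint A & S] ->
  (forall u, u \in A -> ~ expanding y0 L Yb (u |: S)) ->
  4 * (M.*2 + f + y0) + M.*2 < #|L| ->
  #|nbh A :&: L| <= 4 * (M.*2 + f).
Proof.
move=> sLW ex cf cA dAS badA big.
pose ok Z := [&& Z \subset (S :\: Yb) :|: A, #|nbh Z :&: L| <= 4 * #|Z| & #|Z| <= M.*2 + f].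
have ok0 : ok set0.
  rewrite /ok sub0set cards0 leq0n andbT leqn0 cards_eq0; apply/eqP/setP=> x.
  rewrite in_setI in_set0; apply/negbTE; rewrite negb_and; apply/orP; left.
  by apply/negP=> /nbhP[y]; rewrite inE.
have [Z /and3P[sZ nZ cZ] maxZ] := arg_maxnP (fun Z : {set T} => #|Z :&: A|) ok0.
suff sAZ : A \subset Z.
  apply: leq_trans (subset_leq_card (setSI _ (nbhS e sAZ))) _.
  by apply: leq_trans nZ _; rewrite leq_mul2l cZ.
apply/subsetP=> u uA; apply: contrapT => /negP uZ; apply: (badA u uA) => Y sY cY.
rewrite leqNgt; apply/negP=> lt4.
have uS : u \notin S by rewrite (disjointFr dAS).
have uY : u \in Y.
  apply: contrapT => /negP uY; suff : 4 * #|Y| <= #|nbh Y :&: L| by rewrite leqNgt lt4.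
  apply: ex => //; apply/subsetP=> x xY; have := subsetP sY _ xY; rewrite !inE.
  by case: eqP => [xu|_] //=; move: uY; rewrite -xu xY.
have sI : Z :&: Y \subset S :\: Yb.
  apply/subsetP=> x; rewrite inE => /andP[xZ xY]; have := subsetP sY _ xY; rewrite !inE.
  by case: eqP => [xu|_] //=; move: uZ; rewrite -xu xZ.
have nI : 4 * #|Z :&: Y| <= #|nbh (Z :&: Y) :&: L|.
  by apply: ex => //; apply: leq_trans cY; apply: subset_leq_card; apply: subsetIr.
have sub : #|nbh (Z :|: Y) :&: L| + #|nbh (Z :&: Y) :&: L| <= #|nbh Z :&: L| + #|nbh Y :&: L|.
  rewrite nbhU setIUl -(cardsUI (nbh Z :&: L)) leq_add2l; apply: subset_leq_card.
  rewrite subsetI; apply/andP; split; apply: setSI; apply: nbhS.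
    exact: subsetIl.
  exact: subsetIr.
have nU : #|nbh (Z :|: Y) :&: L| <= 4 * #|Z :|: Y|.
  by have := cardsUI Z Y; alia.
have cU0 : #|Z :|: Y| <= M.*2 + f + y0.
  by apply: leq_trans (leq_card_setU _ _) _; alia.
have sU : Z :|: Y \subset (S :\: Yb) :|: A.
  rewrite subUset sZ; apply/subsetP=> x xY; have := subsetP sY _ xY; rewrite !inE.
  by case: eqP => [->|_] /=; rewrite ?uA ?orbT // => ->.
(* With [M] vertices in [W] the union would see almost all of [L], too much for a badly expanding
   set. This keeps the union within the size bound of [ok]. *)
have UW : #|(Z :|: Y) :&: W| < M.
  rewrite ltnNge; apply/negP=> cUW.
  have := joined_nbh (subsetIr (Z :|: Y) W) sLW cUW.
  have : #|nbh ((Z :|: Y) :&: W) :&: L| <= #|nbh (Z :|: Y) :&: L|.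
    by apply: subset_leq_card; apply: setSI; apply: nbhS; apply: subsetIl.
  by alia.
have cU : #|Z :|: Y| <= M.*2 + f.
  rewrite -(cardsID W (Z :|: Y)).
  have : #|(Z :|: Y) :\: W| <= f + M.
    apply: leq_trans (leq_add cf cA); apply: leq_trans (leq_card_setU _ _).
    apply: subset_leq_card; apply/subsetP=> x; rewrite in_setD => /andP[xW /(subsetP sU)].
    by rewrite !in_setU !in_setD xW => /orP[/andP[_ ->]|->]; rewrite ?orbT.
  by alia.
have /maxZ : ok (Z :|: Y) by rewrite /ok sU nU cU.
suff : #|Z :&: A| < #|(Z :|: Y) :&: A| by rewrite ltnNge => /negP.
apply: proper_card; apply/properP; split; first by apply: setSI; apply: subsetUl.
by exists u; rewrite !inE ?uY ?orbT ?uA // (negbTE uZ).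
Qed.

(** Vertices of [A] in [Yb] have no neighbour in [L], and those whose insertion destroys expansion
    see little of [L] by [bad_union]. If no other vertex of [A] is adjacent to a head, the heads in
    [L] outside that small neighbourhood are not adjacent to [A], and the bound [15 * f + 29 * M]
    leaves at least [M] of them. *)
Lemma insert_or_split x0 y0 L Yb p f A : flexible x0 y0 L Yb p ->
  #|[set x in p] :\: L| <= f -> f + M <= y0 ->
  #|A| <= M -> [disjoint A & [set x in p]] ->
  4 * (M.*2 + f + y0) + M.*2 < #|L| -> 15 * f + 29 * M <= #|L| ->
  (exists u q, [/\ u \in A, reach e x0 L p q, e u (nth x0 q 0), u \notin Yb &
      expanding y0 L Yb (u |: [set x in p])])
  \/ exists B, [/\ B \subset [set x in p], M <= #|B| & [disjoint B & clos A]].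
Proof.
move=> flx cf fy cA dA big1 big2.
have [RW LR] := flexible_heads flx cf fy.
case: flx => [[up sp p0] hY [sLp sLW] dLY ex].
set R := heads e x0 L p in RW LR *.
pose Ab := [set u in A | (u \notin Yb) && `[< ~ expanding y0 L Yb (u |: [set x in p]) >]].
have nAb : #|nbh Ab :&: L| <= 4 * (M.*2 + f).
  have sAb : Ab \subset A by apply/subsetP=> u; rewrite inE => /andP[].
  apply: (bad_union sLW ex) => //.
  - by apply: leq_trans cf; apply: subset_leq_card; apply: setDS.
  - exact: leq_trans (subset_leq_card sAb) cA.
  - by apply: disjointWl dA.
  by move=> u; rewrite inE => /and3P[_ _ /asboolP].
have [yes|no] := pselect (exists u q, [/\ u \in A, reach e x0 L p q, e u (nth x0 q 0),
  u \notin Yb & expanding y0 L Yb (u |: [set x in p])]); first by left.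
right; exists ((R :&: L) :\: nbh Ab); split.
- apply: subset_trans (subsetDl _ _) _; apply: subset_trans (subsetIr _ _) _; exact: sLp.
- have c1 : #|R| <= #|R :&: L| + f.
    rewrite -(cardsID L R) leq_add2l; apply: leq_trans cf; apply: subset_leq_card.
    by apply: setSD; apply: heads_sub.
  have c2 : #|R :&: L| <= #|(R :&: L) :\: nbh Ab| + #|nbh Ab :&: L|.
    rewrite -(cardsID (nbh Ab) (R :&: L)) addnC leq_add2l; apply: subset_leq_card.
    by rewrite subsetI subsetIr /=; apply: subset_trans (subsetIl _ _) (subsetIr _ _).
  by alia.
apply/pred0P=> x /=; apply/negbTE/negP=> /andP[]; rewrite in_setD in_setI => /and3P[xAb xR xL].
rewrite in_setU => /orP[xA|/nbhP[u uA eux]].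
  by have := disjointFr dA xA; rewrite (subsetP sLp).
have [uY|uY] := boolP (u \in Yb).
  have := disjointFr dLY xL; suff -> : x \in nbh Yb by [].
  by apply/nbhP; exists u.
have [uex|nuex] := pselect (expanding y0 L Yb (u |: [set x in p])).
  by case/headsP: xR => q rq hq; apply: no; exists u, q; rewrite hq.
case/negP: xAb; apply/nbhP; exists u => //; rewrite inE uA uY; exact/asboolP.
Qed.

(** [L] and [Yb] are kept, so only [u] can add to the [f] path vertices outside [L]. *)
Lemma flexible_insert x0 y0 L Yb p q u f : flexible x0 y0 L Yb p ->
  #|[set x in p] :\: L| <= f -> u \notin p -> reach e x0 L p q ->
  e u (nth x0 q 0) -> u \notin Yb -> expanding y0 L Yb (u |: [set x in p]) ->
  flexible x0 y0 L Yb (u :: q) /\ #|[set x in u :: q] :\: L| <= f.+1.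
Proof.
case=> [[up sp p0] hY [sLp sLW] dLY ex] cf up' rq euq uY exu.
have pq := reach_perm rq.
have eS : [set x in u :: q] = u |: [set x in p].
  by apply/setP=> x; rewrite !inE (perm_mem pq).
split; last first.
  rewrite eS; apply: leq_trans (_ : #|u |: ([set x in p] :\: L)| <= _).
    by apply: subset_leq_card; apply/subsetP=> x; rewrite !inE; case: eqP.
  by apply: leq_trans (leq_card_setU _ _) _; rewrite cards1 add1n ltnS.
split=> //.
- split=> //; first by rewrite /= (perm_mem pq) up' (perm_uniq pq).
  have := reach_sorted e_sym sp rq; have := perm_size pq.
  by case: q {rq pq eS} euq p0 => [|y q] /= euy; [case: p up sp hY sLp ex cf up' exu|move=> _ _ ->; rewrite euy].
- by split=> //; rewrite eS; apply: subset_trans sLp (subsetUr _ _).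
- by rewrite eS.
Qed.

End Joined.

(** * Closing a long path in a joined set to a cycle of length [n] *)

Section JoinedCycle.
Variables (T : finType) (e : rel T).
Hypotheses (e_sym : symmetric e) (e_irr : irreflexive e).
Implicit Types (A B X Y Z L S Yb : {set T}) (p q : seq T).
Variables (M n a : nat) (ms : seq nat) (W X : {set T}).
Hypotheses (M_gt0 : 0 < M) (joinedW : ~~ fam e (nseq 2 M) W) (sWX : W \subset X) (aM : a <= M).
(** This stands for the induction on the number of parts, applied to the vertices off a path. *)
Hypothesis IHc : forall P : {set T}, P \subset X -> #|P| < n ->
  (exists A, [/\ A \subset X :\: P, #|A| <= M & fam e ms A]) \/ has_cycle e n X.

(** [j] vertices are still missing. In each round [IHc] yields a set [A] off the path; either a
    vertex of [A] is inserted, or path vertices not adjacent to [A] supply the class of size [a].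
    The part [rest] is not touched, since rotations fix the last vertex of [p]. *)
Lemma insert_loop x0 y0 L Yb rest F j p f :
  flexible e W x0 y0 L Yb p -> #|[set x in p] :\: L| <= f -> f + j <= F ->
  F + M <= y0 -> 4 * (M.*2 + F + y0) + M.*2 < #|L| -> 15 * F + 29 * M <= #|L| ->
  size p + size rest + j = n -> gpath e X (p ++ rest) ->
  (exists p', [/\ flexible e W x0 y0 L Yb p', #|[set x in p'] :\: L| <= F,
     size (p' ++ rest) = n & gpath e X (p' ++ rest)])
  \/ (has_cycle e n X \/ fam e (a :: ms) X).
Proof.
move=> flx cf fF Fy big1 big2; elim: j p f flx cf fF => [|j IH] p f flx cf fF szn gp.
  left; exists p; split=> //; first by alia.
  by rewrite size_cat; alia.
have [up sp ap] := and3P gp.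
have sP : [set x in p ++ rest] \subset X.
  by apply/subsetP=> x; rewrite inE => /(allP ap).
have cP : #|[set x in p ++ rest]| < n.
  by rewrite cardsE (card_uniqP up) size_cat; alia.
have [[A [sA cA fA]]|] := IHc sP cP; last by right; left.
have [sAX dA] : A \subset X /\ [disjoint A & [set x in p ++ rest]].
  by move: sA; rewrite subsetD => /andP[].
have dAp : [disjoint A & [set x in p]].
  by apply: disjointWr dA; apply/subsetP=> x; rewrite !inE mem_cat => ->.
have [|||[u [q [uA rq euq uY exu]]]|[B [sB cB dB]]] :=
  insert_or_split e_sym e_irr M_gt0 joinedW flx cf _ cA dAp.
- by alia.
- by alia.
- by alia.
- have upr : u \notin p ++ rest by have := disjointFr dA uA; rewrite inE => /negbT.
  have up' : u \notin p by apply: contra upr; rewrite mem_cat => ->.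
  have [flx' cf'] := flexible_insert e_sym flx cf up' rq euq uY exu.
  have pq := reach_perm rq; have szq := perm_size pq.
  have p0 : 0 < size p by case: flx => [[]].
  apply: (IH (u :: q) f.+1) => //; first by alia.
    by rewrite /= szq; alia.
  have pqr : perm_eq (q ++ rest) (p ++ rest) by rewrite perm_cat2r.
  apply/and3P; split.
  + by rewrite /= (perm_mem pqr) upr (perm_uniq pqr).
  + have := reach_cat e_sym p0 rq sp.
    by case: q {rq pq pqr flx' cf'} szq euq => [|y q] /=; [alia|move=> _ -> ->].
  + by rewrite /= (subsetP sAX) // (perm_all _ pqr).
right; right; rewrite -cat1s.
apply: famS (fam_cat (X := B) (Y := A) _ _ fA).
- rewrite subUset sAX andbT; apply: subset_trans sB _.
  by apply/subsetP=> x; rewrite inE => xp; apply: (allP ap); rewrite mem_cat xp.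
- by rewrite (clos_disjointC e_sym).
have [C sC cC] := exists_subset_card (leq_trans aM cB).
by apply/fam_consP; exists C.
Qed.

(** The path is split into [l], [mid] and [r], where [l] and [r] have size [q]. Both ends are made
    flexible but only the first is lengthened; at length [n], joinedness gives an edge between the
    heads of the two ends. *)
Lemma joined_case p0 (q : nat) : gpath e W p0 -> size p0 <= n -> q.*2 <= size p0 ->
  15 * (n - size p0) + 139 * M <= q -> has_cycle e n X \/ fam e (a :: ms) X.
Proof.
move=> gp0 sn q2 bigq.
have [up0 sp0 ap0] := and3P gp0.
have [x0 _] : exists x, x \in p0.
  have : 0 < size p0 by alia.
  by case: (p0) => [|x p] // _; exists x; rewrite mem_head.
(* The defect starts at no more than [5 * M]. Each insertion adds one, and insertions replace the
   [n - size p0] missing vertices and at most [2 * M] cut off at the ends. *)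
pose f := 7 * M + (n - size p0); pose y0 := f + M.
pose l := take q p0; pose mid := take (size p0 - q.*2) (drop q p0).
pose r := drop (size p0 - q.*2) (drop q p0).
have ep0 : p0 = l ++ (mid ++ r) by rewrite /mid cat_take_drop cat_take_drop.
have sl : size l = q by rewrite size_takel //; alia.
have sr : size r = q by rewrite /r !size_drop; alia.
have smid : size mid = size p0 - q.*2 by rewrite /mid size_takel // size_drop; alia.
clearbody l mid r.
have bigl : 4 * (y0 + M) + M.*2 + M < q by rewrite /y0 /f; alia.
move: up0; rewrite ep0 cat_uniq cat_uniq => /and3P[ul _ /and3P[umid _ ur]].
move: (sp0); rewrite ep0 !(sorted_catE e x0) => /and3P[sl' /and3P[smid' sr' _] _].
move: (ap0); rewrite ep0 !all_cat => /and3P[al amid ar].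
have [d1 [L1 [Y1 [d1M flx1 cL1]]]] : exists d L Yb, [/\ d <= M,
    flexible e W x0 y0 L Yb (drop d l) & size l <= #|L| + 5 * M].
  by apply: flexible_init => //; rewrite sl.
have [d2 [L2 [Y2 [d2M flx2 cL2]]]] : exists d L Yb, [/\ d <= M,
    flexible e W x0 y0 L Yb (drop d (rev r)) & size (rev r) <= #|L| + 5 * M].
  apply: flexible_init => //; rewrite ?rev_uniq ?(sorted_rev e_sym) ?all_rev //.
  by rewrite size_rev sr.
set p1 := drop d1 l in flx1; set p2 := drop d2 (rev r) in flx2.
have szp1 : size p1 = q - d1 by rewrite size_drop sl.
have szp2 : size p2 = q - d2 by rewrite size_drop size_rev sr.
pose rest := mid ++ rev p2.
have er2 : rev p2 = take (q - d2) r by rewrite /p2 drop_rev revK sr.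
have sub1 : exists s1 s2, p0 = s1 ++ (p1 ++ rest) ++ s2.
  exists (take d1 l), (drop (q - d2) r); rewrite ep0 /rest er2 -!catA cat_take_drop.
  by rewrite /p1 [in RHS]catA cat_take_drop.
have gp1 : gpath e W (p1 ++ rest).
  have [s1 [s2 e0]] := sub1; have := gpath_take (size (p1 ++ rest)) (gpath_drop (size s1) gp0).
  by rewrite e0 drop_size_cat // take_size_cat.
have gp1X := gpathS sWX gp1.
have defect p L d : size p = q - d -> uniq p -> L \subset [set x in p] -> q <= #|L| + 5 * M ->
    #|[set x in p] :\: L| <= 5 * M.
  move=> sp up sLp cL; rewrite cardsD (setIidPr sLp) cardsE (card_uniqP up) sp; alia.
have cf1 : #|[set x in p1] :\: L1| <= 5 * M.
  by case: flx1 => [[u1 _ _] _ [s1 _] _ _]; apply: (defect _ _ d1); rewrite // -sl.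
have cf2 : #|[set x in p2] :\: L2| <= 5 * M.
  by case: flx2 => [[u1 _ _] _ [s1 _] _ _]; apply: (defect _ _ d2); rewrite // -sr -size_rev.
have szrest : size rest = size p0 - q.*2 + (q - d2) by rewrite /rest size_cat size_rev smid szp2.
have [||||||[p [flx cf szn gp]]|//] := insert_loop (j := n - size (p1 ++ rest)) (F := f)
   (rest := rest) flx1 cf1.
- by rewrite size_cat szp1 szrest /f; alia.
- by [].
- by rewrite /y0 /f; move: cL1; rewrite sl; alia.
- by rewrite /f; move: cL1; rewrite sl; alia.
- by rewrite size_cat szp1 szrest; alia.
- by [].
have [RW1 _] := flexible_heads e_sym e_irr M_gt0 joinedW flx cf (leqnn _).
have [RW2 _] : M <= #|heads e x0 L2 p2 :&: W| /\ #|L2| <= 3 * #|heads e x0 L2 p2| + M.*2.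
  by apply: (flexible_heads e_sym e_irr M_gt0 joinedW flx2 cf2); rewrite /y0 /f; alia.
have [[_ _ pp0] _ _ _ _] := flx; have [[_ _ pp2] _ _ _ _] := flx2.
have [up sp ap] := and3P gp.
have dR : [disjoint heads e x0 L1 p :&: W & heads e x0 L2 p2 :&: W].
  apply/pred0P=> x /=; apply/negbTE/negP=> /andP[]; rewrite !in_setI => /andP[x1 _] /andP[x2 _].
  have := subsetP (heads_sub e x0 L1 pp0) _ x1; have := subsetP (heads_sub e x0 L2 pp2) _ x2.
  rewrite !inE => xp2 xp; move: up; rewrite cat_uniq => /and3P[_ /hasPn/(_ x) + _].
  by rewrite /rest mem_cat mem_rev xp2 orbT xp => /(_ isT).
have [u [v [/setIP[/headsP[q1 rq1 hq1] _] /setIP[/headsP[q3 rq2 hq2] _] euv]]] :=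
  joined_edge joinedW (subsetIr _ _) (subsetIr _ _) RW1 RW2 dR.
left; exists (q1 ++ mid ++ rev q3).
have pc : perm_eq (q1 ++ mid ++ rev q3) (p ++ rest).
  apply: perm_cat (reach_perm rq1) _; rewrite perm_cat2l perm_rev perm_sym perm_rev perm_sym.
  exact: reach_perm rq2.
have sz1 := perm_size (reach_perm rq1); have sz2 := perm_size (reach_perm rq2).
split.
- by rewrite (perm_size pc).
- by rewrite (perm_uniq pc).
- have := reach_cat e_sym pp0 rq1 sp.
  rewrite -(sorted_rev e_sym) /rest !rev_cat revK -catA => /(reach_cat e_sym pp2 rq2).
  rewrite -(sorted_rev e_sym) !rev_cat !revK -catA => sc.
  apply: (cycle_sorted (x0 := x0) sc).
  have -> : head x0 (q1 ++ mid ++ rev q3) = u.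
    by case: q1 sz1 hq1 {rq1 pc sc} => [|y q1] //= sz1; exfalso; alia.
  have -> : last x0 (q1 ++ mid ++ rev q3) = v.
    rewrite !last_cat; case: q3 sz2 hq2 {rq2 pc sc} => [|y q3] /=; first by alia.
    by rewrite rev_cons last_rcons.
  by rewrite e_sym.
- by rewrite (perm_all _ pc).
Qed.

End JoinedCycle.

(** * Anticomplete families and expansion *)

Section FamilyNumber.
Variables (T : finType) (e : rel T) (M : nat).
Hypotheses (e_sym : symmetric e) (M_gt0 : 0 < M).
Implicit Types (A B X Y W : {set T}).

(** The bound on [j] loses nothing: [j] disjoint sets of positive size [M] need at least [j]
    vertices. *)
Definition fnum X := \max_(j < #|T|.+1 | fam e (nseq j M) X) (j : nat).

Lemma fnum_ge X j : fam e (nseq j M) X -> j <= fnum X.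
Proof.
move=> fX; have jT : j < #|T|.+1.
  rewrite ltnS; apply: leq_trans (leq_pmulr j M_gt0) _; apply: leq_trans (fam_nseq_card fX) _.
  exact: max_card.
by apply: (@leq_bigmax_cond _ _ (fun j : 'I__ => j : nat) (Ordinal jT)).
Qed.

Lemma fam_fnum X : fam e (nseq (fnum X) M) X.
Proof.
have [|i fi ei] := @eq_bigmax_cond _ [pred j : 'I_#|T|.+1 | fam e (nseq j M) X] (fun j => j : nat).
  by apply/card_gt0P; exists ord0.
by rewrite (_ : fnum X = i) // -ei; apply: eq_bigl.
Qed.

Lemma fnum_gt0 X : M <= #|X| -> 0 < fnum X.
Proof.
move=> cX; apply: fnum_ge; have [B sB cB] := exists_subset_card cX.
by apply/fam_consP; exists B.
Qed.

Lemma fnum_add A B X : A \subset X -> B \subset X -> [disjoint clos e A & B] ->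
  fnum A + fnum B <= fnum X.
Proof.
move=> sA sB dAB; apply: fnum_ge; rewrite nseqD.
apply: famS (fam_cat dAB (fam_fnum A) (fam_fnum B)); by rewrite subUset sA.
Qed.

Lemma fnumS A B : A \subset B -> fnum A <= fnum B.
Proof. by move=> sAB; apply: fnum_ge; apply: famS sAB (fam_fnum A). Qed.

Variables (n0 dl : nat).

Definition psi w := w * (n0 + dl * trunc_log 2 w).

(** As [a + b] is at least [2 * a], its binary logarithm exceeds that of [a] by at least one; this
    gains [dl * a]. *)
Lemma psi_add a b : 0 < a -> a <= b -> psi a + psi b + dl * a <= psi (a + b).
Proof.
move=> a0 ab; have ta : (trunc_log 2 a).+1 <= trunc_log 2 (a + b).
  apply: trunc_log_max => //; rewrite expnS mul2n -addnn.
  have := trunc_logP (isT : 1 < 2) a0; lia.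
have tb : trunc_log 2 b <= trunc_log 2 (a + b) by apply: leq_trunc_log; lia.
rewrite /psi; move: (trunc_log 2 a) (trunc_log 2 b) (trunc_log 2 (a + b)) ta tb => u v t ut vt.
have h1 : dl * a + a * (dl * u) <= a * (dl * t).
  rewrite mulnCA [X in _ <= X]mulnCA -mulnDr leq_mul2l; apply/orP; right.
  by rewrite -mulnS leq_mul2l ut orbT.
have h2 : b * (dl * v) <= b * (dl * t) by rewrite !leq_mul2l vt !orbT.
by rewrite !mulnDr !mulnDl; lia.
Qed.

Lemma leq_psi a b : a <= b -> psi a <= psi b.
Proof.
move=> ab; apply: leq_mul => //; rewrite leq_add2l leq_mul2l; apply/orP; right.
exact: leq_trunc_log.
Qed.

Lemma heavy_minimal X : M <= #|X| -> psi (fnum X) <= #|X| ->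
  exists W, [/\ W \subset X, 0 < fnum W, psi (fnum W) <= #|W| &
    forall A, A \subset W -> 0 < fnum A -> fnum A < fnum W -> #|A| < psi (fnum A)].
Proof.
move=> cX hX.
pose ok W := [&& W \subset X, 0 < fnum W & psi (fnum W) <= #|W|].
have okX : ok X by rewrite /ok subxx fnum_gt0.
have [W /and3P[sW fW hW] minW] := arg_minnP fnum okX.
exists W; split=> // A sA fA lt; rewrite ltnNge; apply/negP=> hA.
have /minW : ok A by rewrite /ok (subset_trans sA) // fA.
by rewrite leqNgt lt.
Qed.

Definition expander K W := forall A B, A \subset W -> B \subset W ->
  [disjoint clos e A & B] -> M <= #|A| -> M <= #|B| -> #|A| <= #|B| ->
  #|A| <= K * #|W :\: (A :|: B)|.

(** [A] and [B] have smaller family numbers than [W], so by minimality they are lighter than [psi].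
    The separator must make up for the surplus in [psi_add], so it has at least [dl * a] vertices,
    where [a] is the smaller of the two numbers, while [psi a] is at most [a * n]. *)
Lemma heavy_expander n K W : psi (fnum W) <= #|W| ->
  (forall A, A \subset W -> 0 < fnum A -> fnum A < fnum W -> #|A| < psi (fnum A)) ->
  (forall w, w < fnum W -> psi w <= w * n) -> n <= K * dl -> expander K W.
Proof.
move=> hW minW psin nK A B sA sB dAB cA cB AB.
have fA := fnum_gt0 cA; have fB := fnum_gt0 cB; have fAB := fnum_add sA sB dAB.
have lA : #|A| < psi (fnum A) by apply: minW => //; lia.
have lB : #|B| < psi (fnum B) by apply: minW => //; lia.
have cW : #|W| <= #|A| + #|B| + #|W :\: (A :|: B)|.
  rewrite -(cardsID (A :|: B) W) leq_add2r; apply: leq_trans (subset_leq_card (subsetIr _ _)) _.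
  exact: leq_card_setU.
have key a b : 0 < a -> a <= b -> a + b <= fnum W -> psi a + psi b <= psi (fnum A) + psi (fnum B) ->
    psi (fnum A) + psi (fnum B) <= psi a + psi b -> psi a <= K * #|W :\: (A :|: B)|.
  move=> a0 ab abW e1 e2; have := psi_add a0 ab; have := leq_psi abW => h1 h2.
  have h3 : dl * a <= #|W :\: (A :|: B)| by lia.
  apply: leq_trans (psin a _) _; first by lia.
  apply: leq_trans (_ : K * (dl * a) <= _); last by rewrite leq_mul2l h3 orbT.
  by rewrite mulnA mulnC leq_mul2r nK orbT.
have [fle|flt] := leqP (fnum A) (fnum B).
  by apply: leq_trans (ltnW lA) (key _ _ fA fle fAB _ _).
(* Here [B] has the smaller family number, and the bound on [#|B|] passes to [#|A|]. *)
apply: leq_trans AB _; apply: leq_trans (ltnW lB) _.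
apply: (key _ (fnum A)) => //; [exact: ltnW|by rewrite addnC|by rewrite addnC|by rewrite addnC].
Qed.

End FamilyNumber.

(** * Walks of bounded length, balls and layers *)

Section Walks.
Variables (T : finType) (e : rel T).
Hypotheses (e_sym : symmetric e).
Implicit Types (A B X Y W G : {set T}) (p : seq T).

Definition linked X x y d := exists p,
  [/\ path e x p, last x p = y, all (fun z => z \in X) (x :: p) & size p <= d].

Lemma linkedS X Y x y c d : X \subset Y -> c <= d -> linked X x y c -> linked Y x y d.
Proof.
move=> sXY cd [p [pp lp ap sp]]; exists p; split=> //; last exact: leq_trans cd.
by apply/allP=> z /(allP ap); apply: (subsetP sXY).
Qed.

Lemma linked_trans X x y z c d : linked X x y c -> linked X y z d -> linked X x z (c + d).
Proof.
move=> [p [pp lp ap sp]] [q [pq lq aq sq]]; exists (p ++ q); split.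
- by rewrite cat_path pp lp.
- by rewrite last_cat lp.
- by rewrite -cat_cons all_cat ap; case/andP: aq.
- by rewrite size_cat leq_add.
Qed.

Lemma linked_sym X x y d : linked X x y d -> linked X y x d.
Proof.
move=> [p [pp lp ap sp]]; exists (rev (belast x p)); split.
- by rewrite -lp rev_path; apply: sub_path pp => a b; rewrite e_sym.
- by case: p {pp sp ap} lp => [|a p] //= _; rewrite rev_cons last_rcons.
- by rewrite -lp -rev_rcons -lastI all_rev.
- by rewrite size_rev size_belast.
Qed.

Lemma linked_uniq X x y d : linked X x y d -> exists p,
  [/\ path e x p, last x p = y, all (fun z => z \in X) (x :: p), size p <= d & uniq (x :: p)].
Proof.
move=> [p [pp lp ap sp]]; case/shortenP: pp lp => q pq uq sub lq.
exists q; split=> //.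
  move: ap => /= /andP[-> ap] /=; apply/allP=> z /sub/(allP ap); exact.
by apply: leq_trans sp; apply: uniq_leq_size => //; case/andP: uq.
Qed.

Definition bd G X : {set T} := (nbh e X :&: G) :\: X.

Fixpoint ball G x i : {set T} := if i is j.+1 then ball G x j :|: bd G (ball G x j) else [set x].

Lemma ball_mono G x i j : i <= j -> ball G x i \subset ball G x j.
Proof.
move=> ij; rewrite -(subnK ij) addnC; elim: (j - i) => [|k IH]; rewrite ?addn0 ?subxx // addnS.
by apply: subset_trans IH (subsetUl _ _).
Qed.

Lemma ball_sub G x i : x \in G -> ball G x i \subset G.
Proof.
move=> xG; elim: i => [|i IH] /=; first by rewrite sub1set.
by rewrite subUset IH; apply: subset_trans (subsetDl _ _) (subsetIr _ _).
Qed.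

Lemma mem_ball G x i : x \in ball G x i.
Proof. by apply: (subsetP (ball_mono G x (leq0n i))); rewrite inE. Qed.

Lemma card_ballS G x i : #|ball G x i.+1| = #|ball G x i| + #|bd G (ball G x i)|.
Proof.
rewrite /= cardsU (_ : _ :&: _ = set0) ?cards0 ?subn0 //.
by apply/setP=> z; rewrite !inE; case: (z \in ball G x i).
Qed.

Lemma ball_nbh G x i y z : y \in ball G x i -> z \in G -> e y z -> z \in ball G x i.+1.
Proof.
move=> yb zG eyz; rewrite /= in_setU; case zb: (z \in ball G x i) => //=.
by rewrite in_setD zb in_setI zG andbT /=; apply/nbhP; exists y.
Qed.

Lemma ball_linked G x i y : x \in G -> y \in ball G x i -> linked G x y i.
Proof.
move=> xG; elim: i y => [|i IH] y.
  by rewrite /= inE => /eqP->; exists [::]; rewrite /= xG.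
rewrite /= in_setU => /orP[/IH|]; first by apply: linkedS.
rewrite in_setD in_setI => /and3P[_ /nbhP[z zb ezy] yG].
rewrite -addn1; apply: linked_trans (IH z zb) _; exists [:: y]; split=> //=; first by rewrite ezy.
by rewrite yG andbT (subsetP (ball_sub i xG)).
Qed.

(** A shortest path from the centre stays in the smaller ball until its last vertex. Its length is
    the same for all vertices of the layer, as the adjustment of cycle lengths requires. *)
Lemma layer_path G x i y : y \in ball G x i.+1 -> y \notin ball G x i -> exists p,
  [/\ path e x (rcons p y), size p = i, uniq (x :: p) & all (fun z => z \in ball G x i) (x :: p)].
Proof.
elim: i y => [|i IH] y yS yn.
  exists [::]; split=> //=; last by rewrite inE eqxx.
  move: yS; rewrite /= in_setU => /orP[yb|]; first by rewrite yb in yn.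
  rewrite in_setD in_setI => /and3P[_ /nbhP[z]]; rewrite inE => /eqP-> exy _.
  by rewrite exy.
move: yS; rewrite [ball _ _ i.+2]/= in_setU => /orP[yb|]; first by rewrite yb in yn.
rewrite in_setD in_setI => /and3P[_ /nbhP[z zb ezy] yG].
have zn : z \notin ball G x i by apply: contra yn => zb'; apply: ball_nbh zb' yG ezy.
have [p [pp sp up ap]] := IH z zb zn.
exists (rcons p z); split.
- by rewrite rcons_path pp last_rcons ezy.
- by rewrite size_rcons sp.
- rewrite -rcons_cons rcons_uniq up andbT; apply: contra zn => /(allP ap); exact.
- rewrite -rcons_cons all_rcons; apply/andP; split=> //; apply/allP=> v /(allP ap).
  by apply: (subsetP (ball_mono G x (leqnSn i))).
Qed.

End Walks.

(** * A large part of an expander in which small sets expand *)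

Section Giant.
Variables (T : finType) (e : rel T).
Hypotheses (e_sym : symmetric e).
Implicit Types (A B X Y F G : {set T}) (p : seq T).
Variables (M K J : nat) (W : {set T}).
Hypotheses (M_gt0 : 0 < M) (K_gt0 : 0 < K) (expW : expander e M K W).

Definition giant G := [/\ G \subset W, 16 * K * #|W :\: G| <= #|W| &
  forall X, X \subset G -> 0 < #|X| -> 8 * #|X| <= #|W| -> #|X| < 2 * K * #|bd e G X|].

(** A largest badly expanding set [A] of at most a quarter of [W] is removed. The expander property,
    with [F] and the boundary of [A] as separator, bounds [A]; a badly expanding small set in the
    remainder could be added to [A]. *)
Lemma giant_exists F : F \subset W -> 16 * K * (M + (2 * K).+1 * #|F|) <= #|W| ->
  exists G, [/\ giant G, G \subset W :\: F & #|W :\: F :\: G| <= M + 2 * K * #|F|].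
Proof.
move=> sF big.
have bigM : 16 * (M + 2 * K * #|F|) <= #|W|.
  apply: leq_trans big; rewrite -[16 * K * _]mulnA leq_mul2l /= -{1}(mul1n (M + _)).
  by apply: leq_mul => //; rewrite leq_add2l leq_mul2r leqnSn orbT.
have bigF : 32 * #|F| <= #|W|.
  by apply: leq_trans bigM; rewrite mulnDr; nia.
pose ok A := [&& A \subset W :\: F, 4 * #|A| <= #|W| & 2 * K * #|bd e (W :\: F) A| <= #|A|].
have ok0 : ok set0.
  rewrite /ok sub0set cards0 /= leqn0 muln_eq0 cards_eq0; apply/orP; right.
  apply/eqP/setP=> x; rewrite in_setD in_setI in_set0 andbC; apply/negbTE/negP.
  by case/andP=> /andP[/nbhP[y]]; rewrite inE.
have [A /and3P[sA cA bA] maxA] := arg_maxnP (fun A : {set T} => #|A|) ok0.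
have cWF : #|W :\: F| + #|F| = #|W| by rewrite cardsD (setIidPr sF) subnK // subset_leq_card.
have cA' : #|A| <= M + 2 * K * #|F|.
  have [lt|ge] := ltnP #|A| M; first by apply: leq_trans (ltnW lt) (leq_addr _ _).
  pose B := (W :\: F) :\: clos e A.
  have dAB : [disjoint clos e A & B].
    by rewrite disjoint_sym disjoints_subset; apply/subsetP=> x; rewrite !inE => /andP[].
  have cB : #|W :\: F| <= #|A| + #|bd e (W :\: F) A| + #|B|.
    rewrite -(cardsID (clos e A) (W :\: F)) leq_add2r.
    apply: leq_trans (leq_card_setU _ _); apply: subset_leq_card; apply/subsetP=> x.
    by rewrite !inE; case: (x \in A) => //=; rewrite andbC.
  have bd2 : 2 * #|bd e (W :\: F) A| <= #|A|.
    by apply: leq_trans bA; rewrite leq_mul2r; apply/orP; right; alia.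
  have AB : #|A| <= #|B| by alia.
  have := expW (subset_trans sA (subsetDl _ _))
     (subset_trans (subsetDl _ _) (subsetDl _ _) : B \subset W) dAB ge (leq_trans ge AB) AB.
  have cS : #|W :\: (A :|: B)| <= #|F| + #|bd e (W :\: F) A|.
    apply: leq_trans (leq_card_setU _ _); apply: subset_leq_card; apply/subsetP=> x.
    rewrite !inE; case: (x \in A) => //=; case: (x \in F) => //=; case: (x \in W); rewrite ?andbF //.
    by rewrite !andbT negbK.
  move=> h; have : 2 * #|A| <= 2 * K * #|F| + 2 * K * #|bd e (W :\: F) A|.
    by rewrite -mulnDr -mulnA leq_mul2l; apply: leq_trans h _; rewrite leq_mul2l cS orbT.
  by alia.
exists (W :\: F :\: A).
have cG : W :\: F :\: (W :\: F :\: A) = A by rewrite setDDr setDv set0U; apply/setIidPr.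
split; last by rewrite cG.
  split.
  - exact: subset_trans (subsetDl _ _) (subsetDl _ _).
  - apply: leq_trans big; rewrite leq_mul2l; apply/orP; right.
    apply: leq_trans (_ : #|F| + #|A| <= _); last by rewrite mulSn; alia.
    apply: leq_trans (leq_card_setU _ _); apply: subset_leq_card; apply/subsetP=> x.
    by rewrite !inE; case: (x \in F); case: (x \in A); case: (x \in W).
  move=> X sX X0 cX; rewrite ltnNge; apply/negP=> bX.
  have [sXF dXA] : X \subset W :\: F /\ [disjoint X & A].
    by move: sX; rewrite subsetD => /andP[].
  have cAX : #|A :|: X| = #|A| + #|X|.
    by rewrite cardsU (_ : A :&: X = set0) ?cards0 ?subn0 //; apply/eqP; rewrite setI_eq0 disjoint_sym.
  suff /maxA : ok (A :|: X) by rewrite cAX; alia.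
  rewrite /ok subUset sA sXF cAX /=; apply/andP; split; first by alia.
  apply: leq_trans (leq_add bA bX); rewrite -mulnDr leq_mul2l; apply/orP; right.
  apply: leq_trans (leq_card_setU _ _); apply: subset_leq_card; apply/subsetP=> x.
  rewrite /bd nbhU !(in_setD, in_setU, in_setI).
  by case: (x \in A); case: (x \in X); case: (x \in F); case: (x \in W); case: (x \in nbh e A);
    case: (x \in nbh e X).
by apply: subsetDl.
Qed.

Section InGiant.
Variables (G : {set T}).
Hypothesis gG : giant G.

Lemma ball_step x i : x \in G -> 8 * #|ball e G x i| <= #|W| ->
  (2 * K).+1 * #|ball e G x i| < 2 * K * #|ball e G x i.+1|.
Proof.
move=> xG small; have [_ _ gX] := gG; rewrite card_ballS mulnDr mulSn addnC ltn_add2l.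
apply: gX => //; first exact: ball_sub.
by apply/card_gt0P; exists x; apply: mem_ball.
Qed.

Lemma ball_large_mono x i j : i <= j -> #|W| < 8 * #|ball e G x i| ->
  #|W| < 8 * #|ball e G x j|.
Proof.
move=> ij h; apply: leq_trans h _; rewrite leq_mul2l /=.
by apply: subset_leq_card; apply: ball_mono.
Qed.

Lemma ball_linear x i : x \in G -> #|W| < 8 * #|ball e G x i| \/ i < #|ball e G x i|.
Proof.
move=> xG; elim: i => [|i [h|IH]]; first by right; rewrite /= cards1.
  by left; apply: ball_large_mono h.
have [small|] := leqP (8 * #|ball e G x i|) #|W|; last first.
  by left; apply: (ball_large_mono (leqnSn i)).
right; have := ball_step xG small; rewrite mulSn card_ballS mulnDr.
case: #|bd _ _ _| => [|b]; first by rewrite muln0 addn0; alia.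
by move=> _; alia.
Qed.

(** Each step gains at least the fraction [1 / (2 * K)] of the ball of radius [i], so [2 * K] steps
    double it. *)
Lemma ball_double x i j : x \in G -> j <= 2 * K -> #|W| < 8 * #|ball e G x (i + j)| \/
  (2 * K + j) * #|ball e G x i| <= 2 * K * #|ball e G x (i + j)|.
Proof.
move=> xG; elim: j => [|j IH] jK; first by right; rewrite !addn0.
have [|h|h] := IH; first exact: ltnW.
  by left; apply: ball_large_mono h; rewrite leq_add2l.
have [small|] := leqP (8 * #|ball e G x (i + j)|) #|W|; last first.
  by left; apply: ball_large_mono (_ : #|W| < 8 * #|ball e G x (i + j)|); rewrite // leq_add2l.
right; have := ball_step xG small; rewrite -addnS.
have : #|ball e G x i| <= #|ball e G x (i + j)|.
  by apply: subset_leq_card; apply: ball_mono; apply: leq_addr.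
by rewrite addnS !mulSn; alia.
Qed.

Lemma ball_exp x i j : x \in G -> #|W| < 8 * #|ball e G x (i + 2 * K * j)| \/
  2 ^ j * #|ball e G x i| <= #|ball e G x (i + 2 * K * j)|.
Proof.
move=> xG; elim: j => [|j [h|h]]; first by right; rewrite muln0 addn0 mul1n.
  by left; apply: ball_large_mono h; rewrite leq_add2l leq_mul2l leqnSn orbT.
have [h2|h2] := ball_double (i + 2 * K * j) xG (leqnn (2 * K)).
  by left; rewrite mulnS (addnC (2 * K)) addnA.
right; rewrite mulnS (addnC (2 * K)) addnA expnS -mulnA.
apply: leq_trans (_ : 2 * #|ball e G x (i + 2 * K * j)| <= _); first by rewrite leq_mul2l h.
rewrite -(@leq_pmul2l (2 * K)) ?muln_gt0 ?K_gt0 //; apply: leq_trans h2.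
by rewrite mulnA leq_mul2r; apply/orP; right; alia.
Qed.

Hypothesis bigJ : #|W| < 8 * (2 ^ J * M).

Lemma ball_big_from x i : x \in G -> M <= #|ball e G x i| ->
  #|W| < 8 * #|ball e G x (i + 2 * K * J)|.
Proof.
move=> xG cM; have [//|h] := ball_exp i J xG.
apply: leq_trans bigJ _; rewrite leq_mul2l /=; apply: leq_trans h.
by rewrite leq_mul2l cM orbT.
Qed.

(** Linear growth reaches size [M] within [M] steps; then [J] doublings suffice. *)
Lemma ball_big x : x \in G -> #|W| < 8 * #|ball e G x (M + 2 * K * J)|.
Proof.
move=> xG; have [h|h] := ball_linear M xG; last by apply: ball_big_from; rewrite // ltnW.
by apply: ball_large_mono h; apply: leq_addr.
Qed.

(** The expander property applies to [X] and the vertices of [G] outside its closed neighbourhood.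
    The separator also contains the vertices of [W] outside [G], which account for at most half of
    the bound. *)
Lemma big_step X Y : X \subset G -> Y \subset G -> [disjoint clos e X & Y] ->
  M <= #|X| -> M <= #|Y| -> #|W| < 8 * #|X| -> #|W| < 8 * #|Y| -> #|W| <= 16 * K * #|bd e G X|.
Proof.
move=> sX sY dXY mX mY cX cY; have [sG cG _] := gG.
pose B := G :\: clos e X.
have sYB : Y \subset B by rewrite subsetD sY disjoint_sym.
have cYB := subset_leq_card sYB.
have dXB : [disjoint clos e X & B].
  by rewrite disjoint_sym disjoints_subset; apply/subsetP=> x; rewrite !inE => /andP[].
have sBW : B \subset W by apply: subset_trans (subsetDl _ _) sG.
have sXW : X \subset W by apply: subset_trans sG.
have cS : #|W :\: (X :|: B)| <= #|W :\: G| + #|bd e G X|.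
  apply: leq_trans (leq_card_setU _ _); apply: subset_leq_card; apply/subsetP=> x.
  rewrite !inE; case: (x \in X) => //=; case: (x \in G) => //=; case: (x \in W); rewrite ?andbF //.
  by rewrite !andbT negbK.
have main : #|W| <= 8 * (K * #|W :\: (X :|: B)|).
  have [XB|BX] := leqP #|X| #|B|.
    have := expW sXW sBW dXB mX (leq_trans mY cYB) XB; alia.
  have := expW sBW sXW _ (leq_trans mY cYB) mX (ltnW BX).
  rewrite (clos_disjointC e_sym) disjoint_sym dXB setUC => /(_ isT); alia.
have h : 2 * (8 * (K * #|W :\: (X :|: B)|)) <= 16 * K * #|W :\: G| + 16 * K * #|bd e G X|.
  by rewrite -mulnDr !mulnA leq_mul2l cS orbT.
by alia.
Qed.

Definition diam := 2 * (M + 2 * K * J) + 16 * K.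

(** Both balls grow beyond an eighth of [W]. While they neither meet nor touch, each further step at
    [x] gains a fraction [1 / (16 * K)] of [W], which cannot go on for [16 * K] steps. *)
Lemma giant_linked x y : 8 * M <= #|W| -> x \in G -> y \in G -> linked e G x y diam.
Proof.
move=> bigM xG yG; set H := M + 2 * K * J.
have bx := ball_big xG; have byy := ball_big yG; rewrite -/H in bx byy.
have [[j [jK [z [zx zy]]]]|no] := pselect (exists j, j <= 16 * K /\
    exists z, z \in ball e G x (H + j) /\ z \in ball e G y H).
  apply: (@linkedS _ _ G _ _ _ ((H + j) + H)) => //; first by rewrite /diam -/H; alia.
  by apply: linked_trans (ball_linked xG zx) (linked_sym e_sym (ball_linked yG zy)).
have grow j : j <= 16 * K -> j * #|W| + 16 * K * #|ball e G x H| <= 16 * K * #|ball e G x (H + j)|.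
  elim: j => [|j IH] jK; first by rewrite mul0n addn0 add0n.
  have dis : [disjoint clos e (ball e G x (H + j)) & ball e G y H].
    apply/pred0P=> z /=; apply/negbTE/negP=> /andP[zx zy]; apply: no; exists j.+1; split=> //.
    exists z; split=> //; rewrite addnS.
    move: zx; rewrite in_setU => /orP[zx|/nbhP[v vx evz]].
      by rewrite /= in_setU zx.
    by apply: ball_nbh vx _ evz; apply: (subsetP (ball_sub e H yG)).
  have lx : #|W| < 8 * #|ball e G x (H + j)| by apply: ball_large_mono bx; apply: leq_addr.
  have := big_step (ball_sub e _ xG) (ball_sub e _ yG) dis _ _ lx byy.
  have -> : M <= #|ball e G x (H + j)| by alia.
  have -> : M <= #|ball e G y H| by alia.
  move=> /(_ isT isT) st; rewrite addnS card_ballS mulnDr mulSn.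
  by have := IH (ltnW jK); alia.
have := grow _ (leqnn _); rewrite -mulnDr leq_mul2l !muln_eq0 /=.
have -> /= : (K == 0) = false by case: (K) K_gt0.
have : #|ball e G x (H + 16 * K)| <= #|W|.
  by apply: subset_leq_card; have [sG _ _] := gG; apply: subset_trans (ball_sub e _ xG) sG.
by alia.
Qed.

End InGiant.
End Giant.

(** * Hubs *)

Section Hubs.
Variables (T : finType) (e : rel T).
Hypotheses (e_sym : symmetric e).
Implicit Types (A B X Y F G H : {set T}) (p : seq T).

Definition star d X := exists2 r, r \in X & forall v, v \in X -> linked e X r v d.

Lemma star_linked d X u v : star d X -> u \in X -> v \in X -> linked e X u v (d + d).
Proof. by case=> r rX lr uX vX; apply: linked_trans (linked_sym e_sym (lr u uX)) (lr v vX). Qed.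

Lemma star_connects d H x0 u v : star d H -> u \in nbh e H -> v \in nbh e H -> exists c,
  [/\ gpath e H c, 0 < size c <= (d + d).+1, e u (head x0 c) & e (last x0 c) v].
Proof.
move=> sH /nbhP[a aH eau] /nbhP[b bH ebv].
have [p [pp lp ap sp up]] := linked_uniq (star_linked sH aH bH).
exists (a :: p); split=> //; first by apply/and3P; split.
  by rewrite /= e_sym.
by rewrite /= lp.
Qed.

Lemma path_prefix_linked X x p v : path e x p -> all (fun z => z \in X) (x :: p) -> v \in p ->
  linked e X x v (size p).
Proof.
move=> pp ap vp; case/splitPr: vp pp ap => p1 p2; rewrite cat_path => /andP[pp1 /= /andP[ev _]].
rewrite all_cat => /andP[xX /andP[ap1 /andP[vX _]]].
exists (rcons p1 v); split.
- by rewrite rcons_path pp1.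
- by rewrite last_rcons.
- by rewrite /= xX all_rcons vX.
- by rewrite size_rcons size_cat /=; alia.
Qed.

Variables (M D w : nat).
Hypothesis M_gt0 : 0 < M.

(** [H] is a star with the largest family number among those whose size is bounded in terms of that
    number. If it left many vertices undominated, these would contain a path on [M] vertices;
    joining it to the root by a walk of length at most [D] would raise the family number. *)
Lemma hub_in G x : x \in G -> (forall y z, y \in G -> z \in G -> linked e G y z D) ->
  ~~ fam e (nseq w.+1 M) G ->
  exists H, [/\ H \subset G, star (D + M) H, #|H| <= 1 + w * (D + M) &
    #|G :\: clos e H| < w * (M + M) + M].
Proof.
move=> xG lG noF.
have fG X : X \subset G -> fnum e M X <= w.
  move=> sX; rewrite leqNgt; apply/negP=> lt; case/negP: noF.
  by apply: famS sX (fam_nseq_le lt (fam_fnum e M X)).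
pose ok H := `[< [/\ H \subset G, star (D + M) H & #|H| <= 1 + fnum e M H * (D + M)] >].
have okx : ok [set x].
  apply/asboolP; split; rewrite ?sub1set ?cards1 //; exists x; first by rewrite inE.
  by move=> v; rewrite inE => /eqP->; exists [::]; rewrite /= inE eqxx.
have [H /asboolP[sH stH cH] maxH] := arg_maxnP (fnum e M) okx.
have f_le := fG H sH.
exists H; split=> //.
  by apply: leq_trans cH _; rewrite leq_add2l leq_mul2r f_le orbT.
rewrite ltnNge; apply/negP=> big.
have [[p gp sp]|] := long_path_or_fam e_sym M_gt0 big; last first.
  by move=> fY; case/negP: noF; apply: famS fY; apply: subsetDl.
have [up sop ap] := and3P gp.
case: p gp sp up sop ap => [|y p] gp sp up sop ap; first by move: sp M_gt0 => /= <-.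
have [r rH lr] := stH.
have yG : y \in G by have /= /andP[] := ap; rewrite inE => /andP[].
have rG := subsetP sH _ rH.
have [q [pq lq aq sq uq]] := linked_uniq (lG _ _ rG yG).
pose H' := H :|: [set z in q] :|: [set z in y :: p].
have sHH' : H \subset H' by apply: subset_trans (subsetUl _ _) (subsetUl _ _).
have rq_in : all (fun z => z \in H') (r :: q).
  rewrite /= (subsetP sHH') //=; apply/allP=> z zq; by rewrite !inE zq orbT.
have yp_in : all (fun z => z \in H') (y :: p).
  by apply/allP=> z zp; rewrite !inE; move: zp; rewrite inE => ->; rewrite orbT.
have lry : linked e H' r y D by exists q.
have fH' : fnum e M H + 1 <= fnum e M H'.
  apply: leq_trans (fnum_add M_gt0 (A := H) (B := [set z in y :: p]) sHH' (subsetUr _ _) _).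
    rewrite leq_add2l; apply: fnum_gt0 => //; rewrite cardsE (card_uniqP up) sp; exact: leqnn.
  rewrite disjoint_sym disjoints_subset; apply/subsetP=> z; rewrite inE => /(allP ap).
  by rewrite in_setD in_setC => /andP[].
have okH' : ok H'.
  apply/asboolP; split.
  - rewrite !subUset sH /=; apply/andP; split; apply/subsetP=> z; rewrite inE.
      by move=> zq; apply: (allP aq); rewrite inE zq orbT.
    by move/(allP ap); rewrite inE => /andP[].
  - exists r; first exact: (subsetP sHH').
    move=> v; rewrite !in_setU => /orP[/orP[vH|]|]; last first.
    + rewrite inE in_cons => /orP[/eqP->|vp]; first by apply: linkedS lry => //; apply: leq_addr.
      apply: linked_trans lry _.
      apply: linkedS (path_prefix_linked (sop : path e y p) yp_in vp) => //.
      by rewrite -sp /=.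
    + rewrite inE => vq; apply: linkedS (path_prefix_linked pq rq_in vq) => //.
      exact: leq_trans sq (leq_addr _ _).
    by apply: linkedS (lr v vH).
  have c1 : #|H'| <= #|H| + D + M.
    apply: leq_trans (leq_card_setU _ _) _; apply: leq_add.
      apply: leq_trans (leq_card_setU _ _) _; rewrite leq_add2l.
      by rewrite cardsE; apply: leq_trans (card_size _) sq.
    by rewrite cardsE; apply: leq_trans (card_size _) _; rewrite sp.
  apply: leq_trans c1 _; apply: leq_trans (_ : 1 + (fnum e M H + 1) * (D + M) <= _).
    by rewrite mulnDl mul1n; alia.
  by rewrite leq_add2l leq_mul2r fH' orbT.
by move: fH'; rewrite addn1 ltnNge => /negP; apply; apply: maxH.
Qed.

End Hubs.

Section HubAvoiding.
Variables (T : finType) (e : rel T).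
Hypotheses (e_sym : symmetric e).
Implicit Types (A B X Y F G H : {set T}) (p : seq T).
Variables (M K J w : nat) (W : {set T}).
Hypotheses (M_gt0 : 0 < M) (K_gt0 : 0 < K) (expW : expander e M K W).
Hypotheses (bigJ : #|W| < 8 * (2 ^ J * M)) (noF : ~~ fam e (nseq w.+1 M) W).

Definition hub_radius := diam M K J + M.

(** The hub is found in the giant part of [W] minus [F], where any two vertices are close. *)
Lemma hub_avoiding F : F \subset W -> 16 * K * (M + (2 * K).+1 * #|F|) <= #|W| ->
  exists H, [/\ H \subset W :\: F, star e hub_radius H, #|H| <= 1 + w * hub_radius &
    #|W :\: F :\: clos e H| <= 2 * M + 2 * K * #|F| + 2 * w * M].
Proof.
move=> sF big; have [G [gG sG cG]] := giant_exists M_gt0 K_gt0 expW sF big.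
have [sGW cWG _] := gG.
have big8 : 16 * M <= #|W|.
  apply: leq_trans big; rewrite -mulnA leq_mul2l /=.
  by apply: leq_trans (leq_addr ((2 * K).+1 * #|F|) M) _; apply: leq_pmull.
have [x xG] : exists x, x \in G.
  apply/set0Pn; apply: contraTneq cWG => ->; rewrite setD0 -ltnNge.
  by rewrite -{1}(mul1n #|W|) ltn_mul2r; apply/andP; split; alia.
have [||H [sH stH cH cU]] := @hub_in _ _ e_sym M (diam M K J) w M_gt0 G x xG.
- move=> y z yG zG; apply: (giant_linked e_sym M_gt0 K_gt0 expW gG bigJ) => //; alia.
- by apply: contra noF; apply: famS.
exists H; split=> //; first exact: subset_trans sG.
have : #|W :\: F :\: clos e H| <= #|W :\: F :\: G| + #|G :\: clos e H|.
  apply: leq_trans (leq_card_setU _ _); apply: subset_leq_card; apply/subsetP=> z.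
  rewrite in_setU 5!in_setD.
  by case: (z \in G); case: (z \in clos e H); case: (z \in F); case: (z \in W).
rewrite (_ : 2 * w * M = w * (M + M)); last by rewrite addnn -mul2n mulnCA mulnA.
by alia.
Qed.

End HubAvoiding.

(** * Cycles in expanders *)

Section Assembly.
Variables (T : finType) (e : rel T).
Hypotheses (e_sym : symmetric e).
Implicit Types (A B X Y F G H : {set T}) (p q : seq T).

Lemma gpath_cat x0 A B p q : gpath e A p -> gpath e B q -> [disjoint A & B] ->
  e (last x0 p) (head x0 q) -> gpath e (A :|: B) (p ++ q).
Proof.
move=> /and3P[up sp ap] /and3P[uq sq aq] dAB epq; apply/and3P; split.
- rewrite cat_uniq up uq andbT; apply/hasPn=> x xq; apply/negP=> xp.
  by have := disjointFr dAB (allP ap _ xp); rewrite (allP aq).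
- by rewrite (sorted_catE e x0) sp sq epq !orbT.
- rewrite all_cat; apply/andP; split; apply/allP=> x; rewrite inE => xin.
    by rewrite (allP ap).
  by rewrite (allP aq) ?orbT.
Qed.

Lemma disjointsUl A B X : [disjoint A :|: B & X] = [disjoint A & X] && [disjoint B & X].
Proof. by rewrite !disjoints_subset subUset. Qed.

Lemma gpath_mem X p : gpath e X p -> [set x in p] \subset X.
Proof. by case/and3P=> _ _ ap; apply/subsetP=> x; rewrite inE => /(allP ap). Qed.

Lemma gpath_self X p : gpath e X p -> gpath e [set x in p] p.
Proof. by case/and3P=> up sp _; apply/and3P; split=> //; apply/allP=> x; rewrite inE. Qed.

Lemma mem_head_seq (x0 : T) p : 0 < size p -> head x0 p \in p.
Proof. by case: p => [|x p] //= _; rewrite mem_head. Qed.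

Lemma mem_last_seq (x0 : T) p : 0 < size p -> last x0 p \in p.
Proof. by case: p => [|x p] //= _; apply: mem_last. Qed.

Lemma last_catr (x0 : T) p q : 0 < size q -> last x0 (p ++ q) = last x0 q.
Proof. by rewrite last_cat; case: q. Qed.

Lemma last_rev_take (x0 : T) j p : 0 < j -> 0 < size p -> last x0 (rev (take j p)) = head x0 p.
Proof. by case: j p => [|j] [|x p] // _ _; rewrite /= rev_cons last_rcons. Qed.

Variables (M K J w : nat) (W : {set T}).
Hypotheses (M_gt0 : 0 < M) (K_gt0 : 0 < K) (expW : expander e M K W).
Hypotheses (bigJ : #|W| < 8 * (2 ^ J * M)) (noF : ~~ fam e (nseq w.+1 M) W).

Local Notation d := (hub_radius M K J).
Local Notation h := (1 + w * hub_radius M K J).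

(** Each hub is chosen to avoid the earlier ones. A vertex off the hubs that is not adjacent to all
    three is left undominated by one of them. *)
Lemma three_hubs : 16 * K * (M + (2 * K).+1 * (3 * h)) <= #|W| ->
  exists H1 H2 H3, [/\ [/\ star e d H1, star e d H2 & star e d H3],
    [/\ [disjoint H1 & H2], [disjoint H1 & H3] & [disjoint H2 & H3]],
    [/\ H1 :|: H2 :|: H3 \subset W & #|H1 :|: H2 :|: H3| <= 3 * h] &
    #|W :\: (H1 :|: H2 :|: H3) :\: (nbh e H1 :&: nbh e H2 :&: nbh e H3)|
      <= 3 * (2 * M + 2 * K * (2 * h) + 2 * w * M)].
Proof.
move=> big.
have bigF F : #|F| <= 3 * h -> 16 * K * (M + (2 * K).+1 * #|F|) <= #|W|.
  move=> cF; apply: leq_trans big; rewrite leq_mul2l leq_add2l leq_mul2l cF !orbT //.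
have hub F : F \subset W -> #|F| <= 2 * h -> exists H, [/\ H \subset W :\: F, star e d H, #|H| <= h &
    #|W :\: F :\: clos e H| <= 2 * M + 2 * K * (2 * h) + 2 * w * M].
  move=> sF cF.
  have [|H [sH stH cH cU]] := hub_avoiding e_sym M_gt0 K_gt0 expW bigJ noF sF.
    by apply: bigF; alia.
  exists H; split=> //; apply: leq_trans cU _.
  by rewrite leq_add2r leq_add2l leq_mul2l cF orbT.
have [|H1 [sH1 st1 cH1 cU1]] := hub set0 (sub0set _); first by rewrite cards0.
have sW1 : H1 \subset W by apply: subset_trans sH1 (subsetDl _ _).
have [|H2 [sH2 st2 cH2 cU2]] := hub H1 sW1; first by alia.
have [sW2 d12] : H2 \subset W /\ [disjoint H2 & H1] by move: sH2; rewrite subsetD => /andP[].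
have c12 : #|H1 :|: H2| <= #|H1| + #|H2| := leq_card_setU _ _.
have [||H3 [sH3 st3 cH3 cU3]] := hub (H1 :|: H2); first by rewrite subUset sW1.
  by alia.
have [sW3 d123] : H3 \subset W /\ [disjoint H3 & H1 :|: H2].
  by move: sH3; rewrite subsetD => /andP[].
exists H1, H2, H3; split=> //.
- split; first by rewrite disjoint_sym.
    by rewrite disjoint_sym; apply: disjointWr d123; apply: subsetUl.
  by rewrite disjoint_sym; apply: disjointWr d123; apply: subsetUr.
- split; first by rewrite !subUset sW1 sW2.
  have c123 : #|H1 :|: H2 :|: H3| <= #|H1 :|: H2| + #|H3| := leq_card_setU _ _.
  by alia.
have := leq_add (leq_add cU1 cU2) cU3; rewrite -[X in _ <= X -> _]/(_ + _ + _).
move=> hs; apply: leq_trans (_ : #|W :\: set0 :\: clos e H1| + #|W :\: H1 :\: clos e H2| +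
  #|W :\: (H1 :|: H2) :\: clos e H3| <= _); last by alia.
apply: leq_trans (leq_add (leq_card_setU _ _) (leqnn _)); apply: leq_trans (leq_card_setU _ _).
apply: subset_leq_card; apply/subsetP=> z; rewrite /clos !(in_setD, in_setU, in_setI, in_set0).
by case: (z \in H1); case: (z \in H2); case: (z \in H3); case: (z \in W);
  case: (z \in nbh e H1); case: (z \in nbh e H2); case: (z \in nbh e H3).
Qed.

(* [Q] lies in one distance class from [r], so cutting [Q] short and returning to
   [r] along a shortest path gives every length in an interval of length [R0]. *)
Lemma adjuster G (Dm : {set T}) r R0 u : giant e K W G -> 8 * M <= #|W| -> 0 < R0 ->
  r \in G -> #|G :\: Dm| <= u ->
  8 * (M + (2 * K * J).+1 * (w * (R0 + M) + M) + u) <= #|W| ->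
  exists i Q, [/\ i <= M + 2 * K * J,
    #|ball e G r i| <= M + (2 * K * J).+1 * (w * (R0 + M) + M) + u,
    gpath e ((ball e G r i.+1 :\: ball e G r i) :&: Dm) Q & size Q = R0].
Proof.
move=> gG bigM R0_gt0 rG cu big; set y1 := w * (R0 + M) + M in big *.
have exM : exists i, M <= #|ball e G r i|.
  exists M; have [h|h] := ball_linear M_gt0 K_gt0 gG M rG; last exact: ltnW.
  by alia.
have [i0 Mi0 mini0] := ex_minnP exM.
have i0M : i0 <= M.
  apply: mini0; have [h|h] := ball_linear M_gt0 K_gt0 gG M rG; last exact: ltnW.
  by alia.
have ci0 : #|ball e G r i0.-1| <= M.
  case: i0 Mi0 mini0 {i0M} => [|i0] Mi0 mini0 /=; first by rewrite cards1.
  by rewrite leqNgt; apply/negP=> /ltnW/mini0; rewrite ltnn.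
have bigb := ball_big_from M_gt0 K_gt0 gG bigJ rG Mi0.
pose lay i := (ball e G r i.+1 :\: ball e G r i) :&: Dm.
(* If all layers from radius [i0.-1] on were thin inside [Dm], the ball would stay small, as only
   [u] vertices of [G] lie outside [Dm]. This contradicts the growth from radius [i0] on. *)
have grow j : (forall k, k < j -> #|lay (i0.-1 + k)| < y1) ->
    #|ball e G r (i0.-1 + j) :&: Dm| <= M + j * y1.
  elim: j => [|j IH] small.
    by rewrite mul0n !addn0; apply: leq_trans (subset_leq_card (subsetIl _ _)) ci0.
  have c1 : #|ball e G r (i0.-1 + j.+1) :&: Dm| <=
      #|ball e G r (i0.-1 + j) :&: Dm| + #|lay (i0.-1 + j)|.
    rewrite addnS; apply: leq_trans (leq_card_setU _ _); apply: subset_leq_card.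
    apply/subsetP=> z; rewrite !(in_setD, in_setU, in_setI).
    case: (z \in Dm); rewrite ?andbF // !andbT.
    by case: (z \in ball e G r (i0.-1 + j)).
  have := IH (fun k kj => small k (ltnW kj)); have := small j (ltnSn _).
  by rewrite mulSn; alia.
have ball_bound j : j <= (2 * K * J).+1 -> (forall k, k < j -> #|lay (i0.-1 + k)| < y1) ->
    #|ball e G r (i0.-1 + j)| <= M + (2 * K * J).+1 * y1 + u.
  move=> jK small; rewrite -(cardsID Dm (ball e G r (i0.-1 + j))).
  apply: leq_add.
    apply: leq_trans (grow _ small) _; by rewrite leq_add2l leq_mul2r jK orbT.
  by apply: leq_trans cu; apply: subset_leq_card; apply: setSD; apply: ball_sub.
have exj : exists j, (j < (2 * K * J).+1) && (y1 <= #|lay (i0.-1 + j)|).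
  apply: contrapT => no.
  have small k : k < (2 * K * J).+1 -> #|lay (i0.-1 + k)| < y1.
    by move=> kj; rewrite ltnNge; apply/negP=> ge; apply: no; exists k; rewrite kj.
  have := ball_bound _ (leqnn _) small.
  have : #|ball e G r (i0 + 2 * K * J)| <= #|ball e G r (i0.-1 + (2 * K * J).+1)|.
    by apply: subset_leq_card; apply: ball_mono; rewrite addnS -addSn leq_add2r leqSpred.
  by alia.
(* In the first thick layer the ball below is still small, and [y1] vertices are enough to force a
   path on [R0] vertices. *)
have [j /andP[jK yj] minj] := ex_minnP exj.
have sL : lay (i0.-1 + j) \subset W.
  apply: subset_trans (subsetIl _ _) _; apply: subset_trans (subsetDl _ _) _.
  by apply: subset_trans (ball_sub e _ rG) _; case: gG.
have [[Q gQ sQ]|fL] := long_path_or_fam e_sym R0_gt0 yj; last first.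
  by case/negP: noF; apply: famS sL fL.
exists (i0.-1 + j), Q; split=> //.
- by apply: leq_add; [apply: leq_trans (leq_pred _) i0M|].
- apply: ball_bound => // [|k kj]; first exact: ltnW.
  rewrite ltnNge; apply/negP=> ge.
  by have := minj k; rewrite ge (ltn_trans kj jK) leqNgt kj => /(_ isT).
Qed.

(** The cycle goes from [r] by a shortest path to a vertex of [Q], back along [Q] to its head, and
    through [H1], [P1], [H2], [P3] and [H3] to [r]. A connection inside a hub has at most
    [(d + d).+1] vertices; [R0] leaves room for three of them and one vertex of [Q]. *)
Lemma expander_cycle n s1 s2 :
  let R0 := 3 * (d + d).+1 + 1 in
  let u := 3 * (2 * M + 2 * K * (2 * h) + 2 * w * M) in
  let b := M + (2 * K * J).+1 * (w * (R0 + M) + M) + u in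
  16 * K * (M + (2 * K).+1 * (3 * h)) <= #|W| ->
  3 * h + (M + 2 * K * (3 * h)) + u < #|W| ->
  8 * b <= #|W| -> 0 < s1 -> 0 < s2 ->
  w * (s1 + M) + M + 3 * h + u + b + R0 <= #|W| ->
  w * (s2 + M) + M + 3 * h + u + b + R0 + s1 <= #|W| ->
  M + 2 * K * J + 2 + s1 + R0 <= n -> n <= s1 + s2 ->
  has_cycle e n W.
Proof.
move=> R0 u b big1 big2 big3 s1_gt0 s2_gt0 big4 big5 big6 big7.
have [H1 [H2 [H3 [[st1 st2 st3] [d12 d13 d23] [sF cF] cU]]]] := three_hubs big1.
set F := H1 :|: H2 :|: H3 in sF cF cU.
set Dm := nbh e H1 :&: nbh e H2 :&: nbh e H3 in cU; rewrite -/u in cU.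
have bigM : 8 * M <= #|W| by rewrite /b in big3; alia.
have [|G [gG sG cG]] := giant_exists M_gt0 K_gt0 expW sF.
  by apply: leq_trans big1; rewrite leq_mul2l leq_add2l leq_mul2l cF !orbT.
have cGD : #|G :\: Dm| <= u.
  by apply: leq_trans cU; apply: subset_leq_card; apply: setSD.
have cW : #|W| <= #|F| + #|W :\: F :\: G| + #|G|.
  have -> : #|W| = #|F| + #|W :\: F|.
    by rewrite cardsD (setIidPr sF) subnKC // subset_leq_card.
  rewrite -addnA leq_add2l -(cardsID G (W :\: F)) addnC leq_add2l.
  by apply: subset_leq_card; apply: subsetIr.
have [r /setIP[rG rD]] : exists r, r \in G :&: Dm.
  apply/set0Pn; rewrite -card_gt0.
  have := cardsID Dm G; have : 2 * K * #|F| <= 2 * K * (3 * h) by rewrite leq_mul2l cF orbT.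
  by alia.
have R0_gt0 : 0 < R0 by rewrite /R0 addn1.
have [i [Q [iM cb gQ sQ]]] := adjuster gG bigM R0_gt0 rG cGD big3.
rewrite -/b in cb; set Bi := ball e G r i in cb gQ.
have sBG : Bi \subset G by apply: ball_sub.
have sBW : Bi \subset W :\: F by apply: subset_trans sG.
have sQL : [set x in Q] \subset (ball e G r i.+1 :\: Bi) :&: Dm by apply: gpath_mem gQ.
have sQG : [set x in Q] \subset G.
  apply: subset_trans sQL _; apply: subset_trans (subsetIl _ _) _.
  by apply: subset_trans (subsetDl _ _) (ball_sub e _ rG).
have sQW : [set x in Q] \subset W :\: F by apply: subset_trans sG.
have cQ : #|[set x in Q]| = R0 by rewrite cardsE -sQ; apply/card_uniqP; case/and3P: gQ.
(* [Z] is the space left for the two long paths; its vertices are adjacent to all three hubs. *)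
pose Z := ((W :\: F) :&: Dm) :\: (Bi :|: [set x in Q]).
have cZ : #|W| <= 3 * h + u + b + R0 + #|Z|.
  have : W \subset F :|: (W :\: F :\: Dm) :|: Bi :|: [set x in Q] :|: Z.
    apply/subsetP=> z zW; rewrite 4!in_setU.
    case zF: (z \in F) => //=; case zD: (z \in Dm); last by rewrite 2!in_setD zD zF zW.
    case zB: (z \in Bi); rewrite ?orbT //; case zQ: (z \in [set x in Q]); rewrite ?orbT //.
    suff -> : z \in Z by rewrite orbT.
    by rewrite in_setD in_setU zB zQ in_setI in_setD zF zW zD.
  move/subset_leq_card=> cc; apply: leq_trans cc _.
  apply: leq_trans (leq_card_setU _ _) _; rewrite leq_add2r.
  apply: leq_trans (leq_card_setU _ _) _; rewrite cQ leq_add2r.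
  apply: leq_trans (leq_card_setU _ _) _; apply: leq_add cb.
  by apply: leq_trans (leq_card_setU _ _) _; apply: leq_add.
have sZW : Z \subset W.
  by apply: subset_trans (subsetDl _ _) _; apply: subset_trans (subsetIl _ _) (subsetDl _ _).
have noZ X : X \subset Z -> ~~ fam e (nseq w.+1 M) X.
  by move=> sX; apply: contra noF; apply: famS; apply: subset_trans sZW.
have [[P1 gP1 sP1]|f1] : (exists2 p, gpath e Z p & size p = s1) \/ fam e (nseq w.+1 M) Z.
  by apply: long_path_or_fam => //; alia.
  2: by have := noZ Z (subxx _); rewrite f1.
have cP1 : #|[set x in P1]| = s1 by rewrite cardsE -sP1; apply/card_uniqP; case/and3P: gP1.
have sP1Z := gpath_mem gP1.
have cZ1 : #|Z :\: [set x in P1]| = #|Z| - s1 by rewrite cardsD (setIidPr sP1Z) cP1.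
have [[P2 gP2 sP2]|f2] : (exists2 p, gpath e (Z :\: [set x in P1]) p & size p = s2) \/
    fam e (nseq w.+1 M) (Z :\: [set x in P1]).
  by apply: long_path_or_fam => //; rewrite cZ1; alia.
  2: by have := noZ (Z :\: [set x in P1]) (subsetDl _ _); rewrite f2.
(* Here [i.+1] counts the shortest path from [r]. The connections and the kept part of [Q] will have
   exactly [R0] vertices together, by the choice of [j] below. *)
pose x := n - i.+1 - s1 - R0.
have x_gt0 : 0 < x by rewrite /x; alia.
have xs2 : x <= s2 by rewrite /x; alia.
pose P3 := take x P2.
have sP3 : size P3 = x by rewrite size_takel // sP2.
have gP3 : gpath e (Z :\: [set x in P1]) P3 by apply: gpath_take.
have inD v : v \in Z -> [/\ v \in nbh e H1, v \in nbh e H2 & v \in nbh e H3].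
  by move=> /setDP[/setIP[_ /setIP[/setIP[-> ->] ->]] _].
have [rH1 rH2 rH3] : [/\ r \in nbh e H1, r \in nbh e H2 & r \in nbh e H3].
  by move: rD => /setIP[/setIP[-> ->] ->].
have hP1 : head r P1 \in Z by apply: (subsetP sP1Z); rewrite inE mem_head_seq // sP1.
have lP1 : last r P1 \in Z by apply: (subsetP sP1Z); rewrite inE mem_last_seq // sP1.
have sP3Z : [set x in P3] \subset Z by apply: subset_trans (gpath_mem gP3) (subsetDl _ _).
have hP3 : head r P3 \in Z by apply: (subsetP sP3Z); rewrite inE mem_head_seq // sP3.
have lP3 : last r P3 \in Z by apply: (subsetP sP3Z); rewrite inE mem_last_seq // sP3.
have hQ : head r Q \in nbh e H1.
  have : head r Q \in [set x in Q] by rewrite inE mem_head_seq // sQ.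
  by move/(subsetP sQL)/setIP=> [_ /setIP[/setIP[]]].
have [c1 [gc1 /andP[c1_gt0 c1d] ec1 ec1']] := star_connects e_sym r st1 hQ (let: And3 a _ _ := inD _ hP1 in a).
have [c2 [gc2 /andP[c2_gt0 c2d] ec2 ec2']] :=
  star_connects e_sym r st2 (let: And3 _ a _ := inD _ lP1 in a) (let: And3 _ a _ := inD _ hP3 in a).
have [c3 [gc3 /andP[c3_gt0 c3d] ec3 ec3']] :=
  star_connects e_sym r st3 (let: And3 _ _ a := inD _ lP3 in a) rH3.
pose j := R0 - (size c1 + size c2 + size c3).
have j_gt0 : 0 < j by rewrite /j /R0; alia.
have jR : j <= R0 by rewrite /j; alia.
pose Q' := rev (take j Q).
have sQ' : size Q' = j by rewrite size_rev size_takel // sQ.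
have gQ' : gpath e [set x in Q] Q'.
  have /and3P[ut st at'] := gpath_take j (gpath_self gQ).
  by apply/and3P; rewrite rev_uniq (sorted_rev e_sym) all_rev.
have lQ' : last r Q' = head r Q by apply: last_rev_take; rewrite // sQ.
(* Wherever [Q] is cut, the first vertex of [Q'] is in the same layer, so its shortest path from [r]
   has a fixed length. *)
have qL : head r Q' \in (ball e G r i.+1 :\: Bi) :&: Dm.
  apply: (subsetP sQL); case/and3P: gQ' => _ _ /allP; apply; by rewrite mem_head_seq // sQ'.
have [p [pp sp up ap]] : exists p, [/\ path e r (rcons p (head r Q')), size p = i, uniq (r :: p) &
    all (fun z => z \in Bi) (r :: p)].
  by move: qL => /setIP[/setDP[q1 q2] _]; apply: layer_path.
have gp : gpath e Bi (r :: p).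
  by apply/and3P; split=> //; move: pp; rewrite rcons_path => /andP[].
have ep : e (last r (r :: p)) (head r Q') by move: pp; rewrite rcons_path => /andP[].
have dF X : X \subset W :\: F -> [/\ [disjoint X & H1], [disjoint X & H2] & [disjoint X & H3]].
  rewrite subsetD => /andP[_ dX]; split; apply: disjointWr dX; rewrite /F.
  - by apply: subset_trans (subsetUl _ _) (subsetUl _ _).
  - by apply: subset_trans (subsetUr H1 _) (subsetUl _ _).
  - exact: subsetUr.
have [b1 b2 b3] := dF _ sBW; have [q1 q2 q3] := dF _ sQW.
have sZF : Z \subset W :\: F by apply: subset_trans (subsetDl _ _) (subsetIl _ _).
have dZB : [disjoint Z & Bi] /\ [disjoint Z & [set x in Q]].
  have : [disjoint Z & Bi :|: [set x in Q]].
    by rewrite disjoints_subset; apply/subsetP=> v; rewrite in_setD in_setC => /andP[].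
  by move=> dd; split; apply: disjointWr dd; rewrite ?subsetUl ?subsetUr.
have [dZB1 dZQ] := dZB.
have sP1F := subset_trans sP1Z sZF; have sP3F := subset_trans sP3Z sZF.
have [e1 e2 e3] := dF _ sP1F; have [f1 f2 f3] := dF _ sP3F.
have dBQ : [disjoint Bi & [set x in Q]].
  rewrite disjoint_sym; apply: disjointWl sQL _; rewrite disjoints_subset; apply/subsetP=> v.
  by rewrite in_setI in_setD in_setC => /andP[/andP[]].
have d1B : [disjoint [set x in P1] & Bi] by apply: disjointWl dZB1.
have d1Q : [disjoint [set x in P1] & [set x in Q]] by apply: disjointWl dZQ.
have d3B : [disjoint [set x in P3] & Bi] by apply: disjointWl dZB1.
have d3Q : [disjoint [set x in P3] & [set x in Q]] by apply: disjointWl dZQ.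
have d31 : [disjoint [set x in P3] & [set x in P1]].
  by have := gpath_mem gP3; rewrite subsetD => /andP[].
have g1 := gpath_cat (x0 := r) gp gQ' dBQ ep.
have sQ'0 : 0 < size Q' by rewrite sQ'.
have g2 : gpath e (Bi :|: [set x in Q] :|: H1) (((r :: p) ++ Q') ++ c1).
  by apply: (gpath_cat (x0 := r)); rewrite ?disjointsUl ?b1 ?q1 // last_catr // lQ'.
have g3 := gpath_cat (x0 := r) g2 (gpath_self gP1).
have sP10 : 0 < size P1 by rewrite sP1.
have sP30 : 0 < size P3 by rewrite sP3.
rewrite !disjointsUl -!(disjoint_sym [set x in P1]) d1B d1Q e1 last_catr // in g3.
have g4 := gpath_cat (x0 := r) (g3 isT ec1') gc2.
rewrite !disjointsUl b2 q2 d12 e2 last_catr // in g4.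
have g5 := gpath_cat (x0 := r) (g4 isT ec2) (gpath_self gP3).
rewrite !disjointsUl -!(disjoint_sym [set x in P3]) d3B d3Q f1 d31 f2 last_catr // in g5.
have g6 := gpath_cat (x0 := r) (g5 isT ec2') gc3.
rewrite !disjointsUl b3 q3 d13 e3 d23 f3 last_catr // in g6.
have {}g6 := g6 isT ec3.
have [ug sg ag] := and3P g6.
eexists; split; last first.
- apply/allP=> v /(allP ag); rewrite !in_setU.
  have inW (A : {set T}) : A \subset W :\: F -> v \in A -> v \in W.
    by move=> sA /(subsetP sA)/setDP[].
  move: sF; rewrite /F !subUset => /andP[/andP[s1' s2'] s3'].
  do 6?[case/orP]; [exact: inW|exact: inW|exact: (subsetP s1')|exact: inW|
     exact: (subsetP s2')|exact: inW|exact: (subsetP s3')].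
- apply: (cycle_sorted (x0 := r) sg); by rewrite last_catr.
- exact: ug.
rewrite !size_cat /= sp sQ' sP1 sP3 /x /j; alia.
Qed.

End Assembly.

(** * Numerical conditions for the cycle in an expander *)

Section ExpanderCase.
Variables (T : finType) (e : rel T).
Hypotheses (e_sym : symmetric e).
Variables (M K J w n n0 : nat) (W : {set T}).
Hypotheses (M_gt0 : 0 < M) (K_gt0 : 0 < K) (J_gt0 : 0 < J) (expW : expander e M K W).
Hypotheses (bigJ : #|W| < 8 * (2 ^ J * M)) (noF : ~~ fam e (nseq w.+1 M) W).
Hypotheses (w_gt1 : 1 < w) (cW : w * n0 <= #|W|) (n0n : 98 * n <= 100 * n0).
Hypothesis bign : 1000 * 100 * (K * (K + J) * (hub_radius M K J + M + 1)) <= n.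

(** The long paths get about [9 * n / 10] and [n / 2] vertices, together more than [n]. As [w] is at
    least 2, the main terms needed for them are at most 0.9 and 0.95 times [w * n], while [W] has at
    least 0.98 times [w * n] vertices. The error terms are bounded by multiples of [wt], which is
    tiny compared with [w * n]. *)
Lemma expander_case : has_cycle e n W.
Proof.
have bg := bign.
set d := hub_radius M K J in bg.
set t := K * (K + J) * (d + M + 1) in bg.
have KJ : K + J <= K * (K + J) by apply: leq_pmull.
have dt : d + M + 1 <= t by apply: leq_pmull; rewrite muln_gt0 K_gt0 addn_gt0 K_gt0.
have Kt : K * (d + M + 1) <= t.
  by rewrite leq_mul2r; apply/orP; right; apply: leq_pmulr; rewrite addn_gt0 K_gt0.
have KKt : K * K * (d + M + 1) <= t.
  by rewrite leq_mul2r leq_mul2l leq_addr !orbT.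
have KJt : K * J * (d + M + 1) <= t.
  by rewrite leq_mul2r leq_mul2l leq_addl !orbT.
clearbody t.
have w1 : 0 < w by apply: ltnW.
pose wt := w * t; have tw : t <= wt by apply: leq_pmull.
have wn0 : 98 * (w * n) <= 100 * #|W|.
  apply: leq_trans (_ : 100 * (w * n0) <= _); last by rewrite leq_mul2l cW.
  by rewrite mulnCA [X in _ <= X]mulnCA leq_mul2l n0n orbT.
have wtn : 1000 * 100 * wt <= w * n by rewrite mulnCA leq_mul2l bg orbT.
have hw : 1 + w * d + M <= w * (d + M + 1).
  by rewrite !mulnDr muln1; have := leq_pmull M w1; lia.
have hwt : 1 + w * d + M <= wt by apply: leq_trans hw _; rewrite leq_mul2l dt orbT.
have Kh : K * (1 + w * d) + K * M <= wt.
  rewrite -mulnDr; apply: leq_trans (_ : K * (w * (d + M + 1)) <= _); first by rewrite leq_mul2l hw orbT.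
  by rewrite mulnCA leq_mul2l Kt orbT.
have KKh : K * (K * (1 + w * d)) <= wt.
  apply: leq_trans (_ : K * K * (w * (d + M + 1)) <= _).
    by rewrite mulnA leq_mul2l; apply/orP; right; apply: leq_trans hw; apply: leq_addr.
  by rewrite mulnCA leq_mul2l KKt orbT.
have wM : w * M <= wt by rewrite leq_mul2l; apply/orP; right; lia.
set h := 1 + w * d in hw hwt Kh KKh.
pose R0 := 3 * (d + d).+1 + 1.
have y1 : w * (R0 + M) + M <= 6 * (w * (d + M + 1)).
  have : M <= w * M by apply: leq_pmull.
  have -> : R0 = 6 * d + 4 by rewrite /R0; lia.
  by rewrite !mulnDr !(mulnCA w); lia.
have KJy : K * (J * (w * (R0 + M) + M)) <= 6 * wt.
  apply: leq_trans (_ : K * J * (6 * (w * (d + M + 1))) <= _).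
    by rewrite mulnA leq_mul2l y1 orbT.
  by rewrite mulnCA leq_mul2l /= mulnCA leq_mul2l KJt orbT.
have y1t : w * (R0 + M) + M <= 6 * wt.
  by apply: leq_trans y1 _; rewrite leq_mul2l /= leq_mul2l dt orbT.
have R0t : R0 <= 6 * wt by rewrite /R0; lia.
pose u := 3 * (2 * M + 2 * K * (2 * h) + 2 * w * M).
have ut : u <= 30 * wt.
  rewrite /u mulnACA -[2 * w * M]mulnA; clearbody h wt R0; clear -hwt Kh wM; lia.
pose b := M + (2 * K * J).+1 * (w * (R0 + M) + M) + u.
have bt : b <= 60 * wt.
  rewrite /b mulSn -[2 * K * J * _]mulnA -[2 * K * _]mulnA; move: y1t KJy.
  by move: (w * (R0 + M) + M) (K * _) => y z; lia.
have KJd : 2 * K * J <= 2 * t.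
  by rewrite -mulnA leq_mul2l /=; apply: leq_trans KJt; apply: leq_pmulr; rewrite addn1.
pose s1 := 9 * n %/ 10; pose s2 := n %/ 2.
have s1n : 10 * s1 <= 9 * n /\ 9 * n < 10 * s1 + 10 by rewrite /s1; lia.
have s2n : 2 * s2 <= n /\ n <= 2 * s2 + 1 by rewrite /s2; lia.
have ws1 : 10 * (w * s1) <= 9 * (w * n).
  by rewrite mulnCA [X in _ <= X]mulnCA leq_mul2l; case: s1n => -> _; rewrite orbT.
have ws2 : 2 * (w * s2) <= w * n by rewrite mulnCA leq_mul2l; case: s2n => -> _; rewrite orbT.
have wn2 : 2 * n <= w * n by rewrite leq_mul2r w_gt1 orbT.
have t_gt0 : 0 < t by lia.
clearbody s1 s2.
apply: (expander_cycle e_sym M_gt0 K_gt0 expW bigJ noF (s1 := s1) (s2 := s2)); rewrite -/d -/R0 -/h -/u -/b.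
- have -> : 16 * K * (M + (2 * K).+1 * (3 * h)) = 16 * (K * M) + 96 * (K * (K * h)) + 48 * (K * h).
    by clear; lia.
  by clearbody u b R0 h wt; clear -Kh KKh wtn wn0; lia.
- have -> : 2 * K * (3 * h) = 6 * (K * h) by clear; lia.
  by clearbody u b R0 h wt; clear -Kh hwt ut wtn wn0 tw t_gt0; lia.
- by clearbody u b R0 h wt; clear -bt wtn wn0; lia.
- by case: s1n; clear -bg t_gt0; lia.
- by case: s2n; clear -bg t_gt0; lia.
- rewrite mulnDr; clearbody u b R0 h wt; clear -ws1 wM hwt ut bt R0t wtn wn0; lia.
- rewrite mulnDr; case: s1n => s1n _; clearbody u b R0 h wt; clear -ws2 s1n wn2 wM hwt ut bt R0t wtn wn0; lia.
- case: s1n => s1n _; rewrite /R0; clear -s1n bg dt KJd t_gt0; lia.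
- case: s1n => _ s1n; case: s2n => _ s2n; clear -s1n s2n bg t_gt0; lia.
Qed.

End ExpanderCase.

(** * The induction on the number of parts *)

Lemma sqr_le_exp2 l : l * l <= 2 * 2 ^ l.
Proof.
have [|l3] := ltnP l 4; first by case: l => [|[|[|[|l]]]].
rewrite -(subnK l3); elim: (l - 4) => [|k IH] //; rewrite addSn expnS; move: IH.
by move: (2 ^ _) => y; nia.
Qed.

Lemma mem_leq_sumn (s : seq nat) x : x \in s -> x <= sumn s.
Proof.
elim: s => [|y s IH] //=; rewrite inE => /orP[/eqP->|/IH]; first exact: leq_addr.
by move=> h; apply: leq_trans h (leq_addl _ _).
Qed.

Lemma trunc_log2_le w l : w < 2 ^ l.+1 -> trunc_log 2 w <= l.
Proof.
move=> wl; rewrite leqNgt; apply/negP=> lt.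
have w0 : 0 < w by case: (w) lt.
have := trunc_logP (isT : 1 < 2) w0; rewrite leqNgt; case/negP; apply: leq_trans wl _.
by rewrite leq_exp2l.
Qed.

Section Core.
Variables (T : finType) (e : rel T) (n M l : nat).
Hypotheses (e_sym : symmetric e) (e_irr : irreflexive e).
Hypotheses (l_gt0 : 0 < l) (bigM : 2 ^ l <= M) (bign : 2 ^ 54 * (l * l * M) <= n).
Hypothesis (bigJ : 2 ^ l.+1 * n <= 8 * (2 ^ (64 * l) * M)).

(** [dl * l] is at most [n / 200], so the logarithmic term changes [psi] little. [K] is twice
    [200 * l] to absorb the rounding in [dl]; [J] is the number of doublings from [M] to a constant
    fraction of [W]. *)
Let K := 400 * l.
Let J := 64 * l.
Let dl := n %/ (200 * l).
Let n0 := n - 1 - dl * l.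

Lemma core_M_gt0 : 0 < M.
Proof. by apply: leq_trans bigM; rewrite expn_gt0. Qed.

Lemma core_nM : 1000 * 1000 * M <= n.
Proof.
apply: leq_trans bign; have : M <= l * l * M by rewrite leq_pmull // muln_gt0 l_gt0.
by move: (l * l * M) => x; lia.
Qed.

Lemma core_nl : 1000 * 1000 * l <= n.
Proof.
apply: leq_trans bign; have : l <= l * l * M.
  by rewrite -mulnA leq_pmulr // muln_gt0 l_gt0 core_M_gt0.
by move: (l * l * M) => x; lia.
Qed.

Lemma core_dl : 200 * (dl * l) <= n.
Proof. by rewrite mulnCA leq_trunc_div. Qed.

Lemma core_K : n <= K * dl.
Proof.
have l2 : 0 < 200 * l by rewrite muln_gt0.
have : n < dl.+1 * (200 * l) by apply: ltn_ceil.
have : 0 < dl by rewrite divn_gt0 //; have := core_nl; lia.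
rewrite /K; move: (dl) => m m0; rewrite mulSn => h.
have : 200 * l <= m * (200 * l) by apply: leq_pmull.
have -> : 400 * l * m = 2 * (m * (200 * l)) by clear; lia.
by move: (m * (200 * l)) h => x; lia.
Qed.

Lemma core_psi w : w < 2 ^ l.+1 -> psi n0 dl w <= w * (n - 1).
Proof.
move=> wl; rewrite /psi leq_mul2l; apply/orP; right.
have : dl * trunc_log 2 w <= dl * l by rewrite leq_mul2l trunc_log2_le ?orbT.
by have := core_dl; have := core_nl; rewrite /n0; lia.
Qed.

(** From [2 ^ l <= M] follows [l * l <= 2 * M], so the hub radius, of order [M + l * l], is of order
    [M]; the factor [K * (K + J)] is of order [l * l]. *)
Lemma core_diam : 1000 * 100 * (K * (K + J) * (hub_radius M K J + M + 1)) <= n.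
Proof.
have lM : l <= M by apply: leq_trans (ltnW (ltn_expl _ _)) bigM.
have llM : l * l <= 2 * M.
  by apply: leq_trans (sqr_le_exp2 l) _; rewrite leq_mul2l.
have dM : hub_radius M K J + M + 1 <= 1000 * 212 * M.
  rewrite /hub_radius /diam /K /J; have := core_M_gt0.
  have -> : 2 * (400 * l) * (64 * l) = 2 * 400 * 64 * (l * l) by lia.
  by move: (l * l) llM => x; lia.
have KK : K * (K + J) = 400 * 464 * (l * l) by rewrite /K /J; lia.
apply: leq_trans bign; apply: leq_trans (_ : 1000 * 100 * (400 * 464 * (l * l) * (1000 * 212 * M)) <= _).
  by rewrite leq_mul2l KK leq_mul2l dM !orbT.
have -> : 1000 * 100 * (400 * 464 * (l * l) * (1000 * 212 * M)) =
  1000 * 100 * (400 * 464 * (1000 * 212)) * (l * l * M) by lia.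
by move: (l * l * M) => x; lia.
Qed.

Theorem cycle_or_fam ms (X : {set T}) : 0 < size ms -> size ms < 2 ^ l.+1 -> sumn ms <= M ->
  (size ms - 1) * (n - 1) + last 0 ms <= #|X| -> has_cycle e n X \/ fam e ms X.
Proof.
elim: ms X => [|a ms IH] X // _ szl sumM.
have M_gt0 := core_M_gt0; have nM := core_nM; have nl := core_nl; have ndl := core_dl.
case: ms IH szl sumM => [|a' ms] IH szl sumM.
  rewrite [size _]/= subnn mul0n add0n [last _ _]/= => aX; right.
  by have [B sB cB] := exists_subset_card aX; apply/fam_consP; exists B.
set ms' := a' :: ms in IH szl sumM *; set k := size ms'.
have k_gt0 : 0 < k by [].
rewrite [size _]/= -/k subSS subn0 -[last 0 _]/(last 0 ms') => cX0.
(* Fixing the exact size gives the upper bound on [#|W|] that the choice of [J] requires. *)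
have [X' sX' cX'] := exists_subset_card cX0.
suff : has_cycle e n X' \/ fam e (a :: ms') X'.
  case=> [[c [sc uc cc ac]]|fX]; last by right; apply: famS fX.
  by left; exists c; split=> //; apply/allP=> x /(allP ac); apply: (subsetP sX').
move: {X cX0 sX'} X' cX' => X cX.
(* If [k.+1] sets of size [M] exist, they can be shrunk to the sizes in [a :: ms']. *)
have [fX|nfX] := boolP (fam e (nseq k.+1 M) X).
  right; apply: (@fam_le _ _ _ M) => //; apply/allP=> x xin; apply: leq_trans sumM.
  exact: mem_leq_sumn.
have fXk : fnum e M X <= k.
  rewrite leqNgt; apply/negP=> lt; case/negP: nfX.
  by apply: fam_nseq_le lt (fam_fnum e M X).
have last_le : last 0 ms' <= M.
  by apply: leq_trans sumM; apply: mem_leq_sumn; rewrite inE /= mem_last orbT.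
have heavyX : psi n0 dl (fnum e M X) <= #|X|.
  apply: leq_trans (leq_psi n0 dl fXk) _; rewrite cX; apply: leq_trans (leq_addr _ _).
  by apply: core_psi; apply: ltnW.
have MX : M <= #|X|.
  rewrite cX; apply: leq_trans (leq_addr _ _); apply: leq_trans (leq_pmull _ k_gt0); lia.
have [W [sW fW hW minW]] := heavy_minimal M_gt0 MX heavyX.
have fWk : fnum e M W <= k by apply: leq_trans fXk; apply: fnumS.
have noW : ~~ fam e (nseq (fnum e M W).+1 M) W.
  by apply/negP=> /(fnum_ge M_gt0); rewrite ltnn.
have cW : fnum e M W * n0 <= #|W|.
  by apply: leq_trans hW; rewrite /psi leq_mul2l leq_addr orbT.
have [w1|w2] := leqP (fnum e M W) 1.
  have ew : fnum e M W = 1 by apply/eqP; rewrite eqn_leq w1.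
  rewrite ew mul1n in noW cW.
  (* Since [W] has at least [n0] vertices and is joined, the search finds a path missing [n] by
     little more than [n / 200]. *)
  have [[p gp sp]|] : (exists2 p, gpath e W p & size p = n0 - 2 * M) \/ fam e (nseq 2 M) W.
    by apply: long_path_or_fam => //; rewrite /n0 in cW *; lia.
    2: by move=> f2; rewrite f2 in noW.
  apply: (@joined_case _ _ e_sym e_irr M n a ms' W X M_gt0 noW sW _ _ p (n %/ 3)) => //.
  - by move: sumM => /=; lia.
  - move=> P sP cP.
    (* Removing at most [n - 1] vertices leaves enough for one part fewer. *)
    have [||||hc|fm] := IH (X :\: P).
    + by [].
    + exact: ltnW.
    + by move: sumM => /=; lia.
    + have kE : k * (n - 1) = (k - 1) * (n - 1) + (n - 1).
        by rewrite -{1}(subnK k_gt0) mulnDl mul1n.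
      by rewrite cardsD (setIidPr sP) cX -/k kE; move: ((k - 1) * _) => z; alia.
    + right; case: hc => c [sc uc cc ac]; exists c; split=> //.
      by apply/allP=> x /(allP ac); rewrite inE => /andP[].
    (* Passing to the union of the family bounds [A] by the sum of the sizes, hence by [M]. *)
    left; have [A [sA cA fA]] := fam_union fm; exists A; split=> //.
    by rewrite cA; move: sumM => /=; lia.
  - by rewrite sp /n0; lia.
  - by rewrite sp /n0; lia.
  - by rewrite sp /n0; lia.
left; suff [c [sc uc cc ac]] : has_cycle e n W.
  by exists c; split=> //; apply/allP=> x /(allP ac); apply: (subsetP sW).
have expW : expander e M K W.
  apply: (heavy_expander M_gt0 hW minW (n := n)) => [w ww|]; last exact: core_K.
  apply: leq_trans (core_psi _) _; last by rewrite leq_mul2l leq_subr orbT.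
  by apply: ltn_trans szl; rewrite ltnS; apply: leq_trans (ltnW ww) fWk.
apply: (@expander_case _ _ e_sym M K J (fnum e M W) n n0) => //.
- by rewrite /K muln_gt0.
- by rewrite /J muln_gt0.
- apply: leq_ltn_trans (subset_leq_card sW) _; apply: leq_trans bigJ; rewrite cX.
  apply: leq_trans (_ : k.+1 * n <= _); last by rewrite leq_mul2r (ltnW szl) orbT.
  rewrite [k.+1 * n]mulSn; have : k * (n - 1) <= k * n by rewrite leq_mul2l leq_subr orbT.
  by move: (k * (n - 1)) (k * n) (last 0 ms') last_le nM M_gt0 => x y z; clear; lia.
- by rewrite /n0; lia.
- exact: core_diam.
Qed.

End Core.

(** * Chromatic number and Ramsey bounds *)

Section BigMin.
Variables (I : finType) (P : pred I) (F : I -> nat) (x0 : nat).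
Local Notation mn := (\big[minn/x0]_(i | P i) F i).

Lemma bigminn_le_idx : mn <= x0.
Proof. by elim/big_rec: _ => // i x _ h; apply: leq_trans (geq_minr _ _) h. Qed.

Lemma bigminn_le i : P i -> mn <= F i.
Proof.
move=> Pi; have : i \in index_enum I by apply: mem_index_enum.
rewrite unlock; elim: (index_enum I) => //= j s IH; rewrite inE => /orP[/eqP<-|/IH h].
  by rewrite Pi geq_minl.
by case: (P j) => //; apply: leq_trans (geq_minr _ _) h.
Qed.

Lemma bigminn_attained : mn = x0 \/ exists2 i, P i & F i = mn.
Proof.
elim/big_rec: _ => [|j x Pj IH]; first by left.
by rewrite /minn; case: ltnP => _; [right; exists j|].
Qed.
End BigMin.

Section Chromatic.
Variables (V : finType) (e : rel V).

Lemma colorable_card : irreflexive e -> colorable e #|V|.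
Proof.
move=> irr; apply/existsP; exists [ffun x => enum_rank x].
apply/forallP=> x; apply/forallP=> y; apply/implyP=> exy; rewrite !ffunE.
by apply: contraTneq exy => /enum_rank_inj->; rewrite irr.
Qed.

Lemma chi_colorable : irreflexive e -> colorable e (chi e).
Proof.
move=> irr; rewrite /chi.
have [->|[i ci <-]] := bigminn_attained (fun k : 'I_#|V|.+1 => colorable e k) (fun k => k : nat) #|V|.
  exact: colorable_card.
exact: ci.
Qed.

Lemma chi_le_card : chi e <= #|V|.
Proof. exact: bigminn_le_idx. Qed.

Lemma chi_le k : colorable e k -> chi e <= k.
Proof.
move=> ck; have [kV|Vk] := ltnP k #|V|.+1.
  exact: (@bigminn_le _ (fun k : 'I_#|V|.+1 => colorable e k) (fun k => k : nat) #|V| (Ordinal kV)).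
by apply: leq_trans chi_le_card (ltnW Vk).
Qed.

Lemma chi_gt0 : irreflexive e -> 0 < #|V| -> 0 < chi e.
Proof.
move=> irr /card_gt0P[x _]; rewrite lt0n; apply/eqP=> c0.
by have := chi_colorable irr; rewrite c0 => /existsP[f _]; case: (f x).
Qed.

Lemma sigma_le (f : {ffun V -> 'I_(chi e)}) i : Defs.proper e f ->
  colour_sigma e <= #|[set x | f x == i]|.
Proof.
move=> pf; apply: leq_trans (bigminn_le _ _ pf) _.
exact: (@bigminn_le _ xpredT (fun i => #|[set x | f x == i]|)).
Qed.

(** If a minimum takes the default value [#|V|], it is still attained: each class then has at least,
    and so exactly, [#|V|] vertices. *)
Lemma sigma_attained : irreflexive e -> 0 < #|V| ->
  exists (f : {ffun V -> 'I_(chi e)}) i, Defs.proper e f /\ #|[set x | f x == i]| = colour_sigma e.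
Proof.
move=> irr V0; have c0 := chi_gt0 irr V0.
have [g pg] := existsP (chi_colorable irr).
have cls (f : {ffun V -> 'I_(chi e)}) : exists i, #|[set x | f x == i]| =
    \big[minn/#|V|]_(i : 'I_(chi e)) #|[set x | f x == i]|.
  have [E|[i _ <-]] := bigminn_attained xpredT (fun i => #|[set x | f x == i]|) #|V|; last by exists i.
  exists (Ordinal c0); apply/eqP; rewrite eqn_leq E max_card -{1}E.
  by apply: (@bigminn_le _ xpredT (fun i => #|[set x | f x == i]|)).
rewrite /colour_sigma.
set Fm := fun f : {ffun V -> 'I_(chi e)} => \big[minn/#|V|]_(i : 'I_(chi e)) #|[set x | f x == i]|.
have [E|[f pf E]] := bigminn_attained (fun f : {ffun V -> 'I_(chi e)} => Defs.proper e f) Fm #|V|.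
  have [i ei] := cls g; exists g, i; split=> //; apply/eqP; rewrite eqn_leq E max_card -{1}E ei.
  exact: (bigminn_le Fm #|V| pg).
by have [i ei] := cls f; exists f, i; split=> //; rewrite ei -E.
Qed.

(** An empty class could be dropped and the other colours renumbered, leaving a proper colouring
    with [(chi e).-1] colours. *)
Lemma sigma_gt0 : irreflexive e -> 0 < #|V| -> 0 < colour_sigma e.
Proof.
move=> irr V0; have [f [i [pf <-]]] := sigma_attained irr V0.
rewrite card_gt0; apply/set0Pn; apply: contrapT => no.
have fi x : i != f x.
  by apply/eqP=> E; apply: no; exists x; rewrite inE -E.
suff /chi_le : colorable e (chi e).-1 by rewrite leqNgt ltn_predL chi_gt0.
apply/existsP; exists [ffun x => s2val (unlift_some (fi x))].
apply/forallP=> x; apply/forallP=> y; apply/implyP=> exy; rewrite !ffunE.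
case: (unlift_some (fi x)) (unlift_some (fi y)) => [jx ex _] [jy ey _] /=.
have /forallP/(_ x)/forallP/(_ y) := pf; rewrite exy ex ey /=.
by apply: contra_neq => ->.
Qed.

End Chromatic.

Lemma has_cycle_contains (W : finType) (eG : rel W) n : symmetric eG -> 0 < n ->
  has_cycle eG n setT -> contains (cycle_rel n) eG.
Proof.
move=> sG n0 [c [sc uc cc _]]; case: c sc uc cc => [|x c] sc uc cc; first by rewrite -sc in n0.
have step (i j : nat) : i < n -> j = i.+1 %% n -> eG (nth x (x :: c) i) (nth x (x :: c) j).
  move=> i_lt ->; rewrite -sc /= in i_lt *.
  move: cc => /= /(pathP x)/(_ i); rewrite size_rcons i_lt => /(_ isT).
  rewrite -rcons_cons nth_rcons /= i_lt nth_rcons.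
  move: i_lt; rewrite ltnS leq_eqVlt => /orP[/eqP ei|i_lt].
    by rewrite ei ltnn eqxx modnn.
  by rewrite i_lt modn_small.
pose f (i : 'I_n) := nth x (x :: c) i.
exists f; split.
  by move=> i j /eqP; rewrite nth_uniq ?sc // => /eqP/val_inj.
by move=> i j /orP[]/eqP h; [|rewrite sG]; apply: step.
Qed.

(** * Embedding a graph colour class by colour class *)

Section Multipartite.
Variables (V W : finType) (eG : rel W) (k : nat) (g : V -> 'I_k) (x0 : W).
Hypothesis sG : symmetric eG.
Let cls i : {set V} := [set x | g x == i].

(** Each class is sent to its set of the family by matching enumerations; different sets are
    disjoint and non-adjacent. *)
Lemma fam_embedding (cs : seq 'I_k) (X : {set W}) : uniq cs -> fam eG [seq #|cls i| | i <- cs] X ->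
  exists F : V -> W, [/\ forall x, g x \in cs -> F x \in X,
    forall x y, g x \in cs -> g y \in cs -> F x = F y -> x = y &
    forall x y, g x \in cs -> g y \in cs -> g x != g y -> ~~ eG (F x) (F y)].
Proof.
elim: cs X => [|c cs IH] X /=; first by exists (fun=> x0).
move=> /andP[ccs ucs] /fam_consP[A [sA cA fA]].
have [F [FX Finj Fe]] := IH _ ucs fA.
pose F0 x := nth x0 (enum A) (index x (enum (cls c))).
have F0A x : g x = c -> F0 x \in A.
  move=> gx; rewrite -mem_enum; apply: mem_nth; rewrite -cardE cA cardE index_mem mem_enum.
  by rewrite inE gx.
have F0inj x y : g x = c -> g y = c -> F0 x = F0 y -> x = y.
  move=> gx gy; have xi : x \in enum (cls c) by rewrite mem_enum inE gx.
  have yi : y \in enum (cls c) by rewrite mem_enum inE gy.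
  move=> /eqP; rewrite nth_uniq ?enum_uniq //; try by rewrite -cardE cA cardE index_mem.
  by move=> /eqP ei; rewrite -(nth_index x xi) ei nth_index.
have FN x : g x \in cs -> F x \notin clos eG A by move/FX; rewrite inE => /andP[].
exists (fun x => if g x == c then F0 x else F x); split.
- move=> x; rewrite inE; case: eqP => [gx _|_ /= /FX]; first exact: (subsetP sA _ (F0A x gx)).
  by rewrite inE => /andP[].
- move=> x y; rewrite !inE; case: eqP => [gx _|_ /= xc]; case: eqP => [gy _|_ /= yc].
  + exact: F0inj.
  + by move=> E; have := FN _ yc; rewrite -E (subsetP (sub_clos eG A)) ?F0A.
  + by move=> E; have := FN _ xc; rewrite E (subsetP (sub_clos eG A)) ?F0A.
  + exact: Finj.
move=> x y; rewrite !inE; case: eqP => [gx _|_ /= xc]; case: eqP => [gy _|_ /= yc].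
- by rewrite gx gy eqxx.
- move=> _; apply: contra (FN _ yc) => E; rewrite inE; apply/orP; right.
  by apply/nbhP; exists (F0 x); rewrite ?F0A.
- move=> _; apply: contra (FN _ xc) => E; rewrite inE; apply/orP; right.
  by apply/nbhP; exists (F0 y); rewrite ?F0A // sG.
exact: Fe.
Qed.

Lemma sum_class : \sum_(i < k) #|cls i| = #|V|.
Proof.
rewrite -sum1_card (partition_big g xpredT) //=; apply: eq_bigr => i _.
by rewrite -sum1_card; apply: eq_bigl => x; rewrite inE.
Qed.

End Multipartite.

Lemma card_ord_ge m a : #|[set v : 'I_m | a <= v]| <= m - a.
Proof.
have [ma|am] := leqP m a.
  rewrite (_ : [set v : 'I_m | a <= v] = set0) ?cards0 //; apply/setP=> v; rewrite !inE.
  by apply/negbTE; rewrite -ltnNge; apply: leq_trans (ltn_ord v) ma.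
have ma0 : 0 < m - a by rewrite subn_gt0.
pose phi (v : 'I_m) : 'I_(m - a).-1.+1 := inord (v - a).
rewrite -(card_in_imset (f := phi)).
  by apply: leq_trans (max_card _) _; rewrite card_ord prednK.
move=> u v; rewrite !inE => au av /(congr1 val); rewrite /= !inordK ?prednK ?ltn_sub2r //.
by move=> E; apply: val_inj; rewrite /= -(subnK au) E subnK.
Qed.

Lemma INR_muln a b : INR (a * b) = Rmult (INR a) (INR b).
Proof. by rewrite -multE mult_INR. Qed.

Lemma INR_expn a b : INR (a ^ b) = pow (INR a) b.
Proof. by elim: b => [|b IH] //; rewrite expnS INR_muln IH. Qed.

Lemma leq_INR a b : Rle (INR a) (INR b) -> a <= b.
Proof. by move=> /INR_le/leP. Qed.

(** The factor 2 comes from [ln 2 > 1/2]. *)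
Lemma trunc_log2_ln k : 0 < k -> Rle (INR (trunc_log 2 k)) (Rmult 2 (ln (INR k))).
Proof.
move=> k0; have := trunc_logP (isT : 1 < 2) k0; set l := trunc_log 2 k => /leP/le_INR.
rewrite INR_expn => h.
have p2 : Rlt 0 (INR 2) by apply: lt_0_INR; lia.
have : Rle (ln (pow (INR 2) l)) (ln (INR k)).
  have [lt|->] := Rle_lt_or_eq_dec _ _ h; last exact: Rle_refl.
  by apply/Rlt_le/ln_increasing => //; apply: pow_lt.
rewrite ln_pow // => h2; have := ln_lt_2; have := pos_INR l.
rewrite (_ : INR 2 = IZR 2) // in h2 => h3 h4; nra.
Qed.

(** * Upper and lower bounds for the Ramsey number *)

Section Bounds.
Variables (V : finType) (e : rel V).
Hypotheses (e_sym : symmetric e) (e_irr : irreflexive e) (V_gt0 : 0 < #|V|).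
Variable n : nat.
Hypothesis n_ge3 : 3 <= n.
Local Notation k := (chi e).

Lemma ramsey_upper M l : 0 < l -> k < 2 ^ l.+1 -> #|V| <= M -> 2 ^ l <= M ->
  2 ^ 54 * (l * l * M) <= n -> 2 ^ l.+1 * n <= 8 * (2 ^ (64 * l) * M) ->
  ramsey_prop (cycle_rel n) e ((k - 1) * (n - 1) + colour_sigma e).
Proof.
move=> l0 kl VM lM bign bigJ eG [sG iG].
have [f [i [pf ei]]] := sigma_attained e_irr V_gt0.
(* A smallest class comes last, since the vertex count in [cycle_or_fam] ends with [last 0 ms]. *)
pose cs := rcons (rem i (enum 'I_k)) i.
have pcs : perm_eq cs (enum 'I_k).
  by rewrite perm_rcons perm_sym perm_to_rem // mem_enum.
have incs c : c \in cs by rewrite (perm_mem pcs) mem_enum.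
pose ms := [seq #|[set x | f x == c]| | c <- cs].
have sz : size ms = k by rewrite size_map (perm_size pcs) size_enum_ord.
have sumV : sumn ms = #|V|.
  by rewrite sumnE big_map (perm_big _ pcs) big_enum /= (sum_class f).
have lms : last 0 ms = colour_sigma e by rewrite /ms map_rcons last_rcons.
have [||||hc|fm] := cycle_or_fam (T := 'I_((k - 1) * (n - 1) + colour_sigma e)) (ms := ms)
   (X := setT) sG iG l0 lM bign bigJ.
- by rewrite sz chi_gt0.
- by rewrite sz.
- by rewrite sumV.
- by rewrite cardsT card_ord sz lms.
- by left; apply: has_cycle_contains => //; apply: leq_trans n_ge3.
right; have [A [_ cA _]] := fam_union fm.
have [x0 _] : exists x, x \in A by apply/card_gt0P; rewrite cA sumV.
have [|F [_ Finj Fe]] := fam_embedding x0 sG (g := f) _ fm.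
  by rewrite (perm_uniq pcs) enum_uniq.
exists F; split=> [x y E|x y exy]; first exact: Finj.
have fxy : f x != f y by have /forallP/(_ x)/forallP/(_ y) := pf; rewrite exy.
rewrite /compl Fe // andbT; apply: contra fxy => /eqP E.
by rewrite (Finj x y).
Qed.

Lemma ramsey_lower_edgeless N : k = 1 -> ramsey_prop (cycle_rel n) e N -> colour_sigma e <= N.
Proof.
move=> k1 rN; have [|[f [_ fe]]|[F [Finj _]]] := rN (fun _ _ => false).
- by split.
- have n0 : 0 < n by apply: leq_trans n_ge3.
  have n1 : 1 < n by apply: leq_trans n_ge3.
  suff : false by []; apply: (fe (Ordinal n0) (Ordinal n1)).
  by rewrite /cycle_rel /= modn_small.
apply: leq_trans (bigminn_le_idx _ _ _) _.
by have := leq_card F Finj; rewrite card_ord.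
Qed.

(** The host is a disjoint union of cliques on at most [n - 1] vertices, the last on fewer than
    [colour_sigma e]. A cycle stays in one clique, which is too small. A copy of [e] in the
    complement is properly coloured by the cliques, with a last class that is too small. *)
Lemma ramsey_lower N : #|V| <= n -> ramsey_prop (cycle_rel n) e N ->
  (k - 1) * (n - 1) + colour_sigma e <= N.
Proof.
move=> Vn rN; rewrite leqNgt; apply/negP=> ltN.
have sV : colour_sigma e <= #|V| by apply: bigminn_le_idx.
have k0 := chi_gt0 e_irr V_gt0.
have n1 : 0 < n - 1 by lia.
(* [minn] only puts the block number in range: as [colour_sigma e] is at most [n], the last block of
   vertices below [N] has at most [n - 1] elements. *)
pose blk v := minn (v %/ (n - 1)) (k - 1).
have blk_lt v : blk v < k by rewrite /blk; move: (v %/ _) => y; lia.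
have blkP v : v < N -> blk v * (n - 1) <= v < blk v * (n - 1) + (n - 1).
  move=> vN; have := divn_eq v (n - 1); have := ltn_pmod v n1.
  rewrite /blk; move: (v %/ _) (v %% _) => q r rn vq; rewrite /minn; case: ltnP => qk.
    by rewrite vq leq_addr ltn_add2l rn.
  have : (k - 1) * (n - 1) <= q * (n - 1) by rewrite leq_mul2r qk orbT.
  move: ((k - 1) * _) (q * _) vq ltN => a b; lia.
pose eG (x y : 'I_N) := (x != y) && (blk x == blk y).
have [|[f [finj fe]]|[F [Finj Fe]]] := rN eG.
- split=> [x y|x]; last by rewrite /eG eqxx.
  by rewrite /eG eq_sym [blk x == _]eq_sym.
- have n0 : 0 < n by apply: leq_trans n_ge3.
  have same (j : nat) (jn : j < n) : blk (f (Ordinal jn)) = blk (f (Ordinal n0)).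
    elim: j jn => [|j IH] jn; first by congr (blk (f _)); apply: val_inj.
    have jn' := ltnW jn; rewrite -(IH jn').
    have : eG (f (Ordinal jn')) (f (Ordinal jn)).
      by apply: fe; rewrite /cycle_rel /= modn_small ?eqxx.
    by case/andP=> _ /eqP.
  pose b := blk (f (Ordinal n0)).
  have inb (j : 'I_n) : b * (n - 1) <= f j < b * (n - 1) + (n - 1).
    by case: j => j jn; have := blkP _ (ltn_ord (f (Ordinal jn))); rewrite same.
  pose phi (j : 'I_n) : 'I_(n - 1).-1.+1 := inord (f j - b * (n - 1)).
  have phi_inj : injective phi.
    move=> i j /(congr1 val); have /andP[i1 i2] := inb i; have /andP[j1 j2] := inb j.
    rewrite /= !inordK ?prednK ?ltn_subLR // => E; apply/finj/val_inj.
    by rewrite /= -(subnK i1) E subnK.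
  have := leq_card phi phi_inj; rewrite !card_ord prednK //; lia.
pose g : {ffun V -> 'I_k} := [ffun x => Ordinal (blk_lt (F x))].
have pg : Defs.proper e g.
  apply/forallP=> x; apply/forallP=> y; apply/implyP=> exy; rewrite !ffunE.
  have := Fe x y exy; rewrite /compl /eG => /andP[xy]; rewrite xy /=.
  by apply: contra => /eqP/(congr1 val) /= ->.
have kl : k - 1 < k by lia.
have := sigma_le (Ordinal kl) pg; rewrite leqNgt; case/negP.
have sub : F @: [set x | g x == Ordinal kl] \subset [set v : 'I_N | (k - 1) * (n - 1) <= v].
  apply/subsetP=> v /imsetP[x]; rewrite inE ffunE => /eqP/(congr1 val) /= bx ->.
  by rewrite inE; have := blkP _ (ltn_ord (F x)); rewrite bx => /andP[].
rewrite -(card_imset _ Finj); apply: leq_ltn_trans (subset_leq_card sub) _.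
apply: leq_ltn_trans (card_ord_ge _ _) _.
by have := sigma_gt0 e_irr V_gt0; move: ltN; move: ((k - 1) * _) => a; lia.
Qed.

End Bounds.

Lemma ramsey_upper_edgeless (V : finType) (e : rel V) n : irreflexive e -> 0 < #|V| ->
  chi e = 1 -> ramsey_prop (cycle_rel n) e ((chi e - 1) * (n - 1) + colour_sigma e).
Proof.
move=> irr V0 k1 eG _; right.
have [f [i [pf ei]]] := sigma_attained irr V0.
have all1 (a b : 'I_(chi e)) : a = b.
  have lt1 (c : 'I_(chi e)) : c < 1 by apply: leq_trans (ltn_ord c) _; rewrite k1.
  by apply: val_inj; have := lt1 a; have := lt1 b => /=; lia.
have sV : #|V| = (chi e - 1) * (n - 1) + colour_sigma e.
  rewrite -ei [in chi e - 1]k1 /= mul0n add0n -cardsT; congr #|pred_of_set _|.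
  by apply/setP=> x; rewrite !inE (all1 (f x) i) eqxx.
exists (fun x => cast_ord sV (enum_rank x)); split=> [x y /cast_ord_inj/enum_rank_inj//|x y exy].
by have /forallP/(_ x)/forallP/(_ y) := pf; rewrite exy (all1 (f x) (f y)) eqxx.
Qed.

(** [M] is [n] divided by [2 ^ 56 * l ^ 4], rounded down. Rounding costs at most a factor 2, and
    [l ^ 4] is at most [2 ^ (4 * l)], so the last bound reduces to comparing exponents linear in
    [l]. *)
Lemma exp2_split l v n : 0 < l -> 2 ^ l <= v -> 2 ^ 56 * (v * l ^ 4) <= n ->
  exists M, [/\ v <= M, 2 ^ l <= M, 2 ^ 54 * (l * l * M) <= n &
    2 ^ l.+1 * n <= 8 * (2 ^ (64 * l) * M)].
Proof.
move=> l0 lv big; pose q := 2 ^ 56 * l ^ 4.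
have q0 : 0 < q by rewrite muln_gt0 !expn_gt0 l0.
pose M := n %/ q.
have vM : v <= M by rewrite leq_divRL // mulnC -mulnA [l ^ 4 * v]mulnC.
have Mq : M * q <= n by apply: leq_trunc_div.
have nq : n < M.+1 * q by apply: ltn_ceil.
have M0 : 0 < M by apply: leq_trans vM; apply: leq_trans lv; rewrite expn_gt0.
exists M; split=> //; first exact: leq_trans vM.
  apply: leq_trans Mq; rewrite mulnA mulnC leq_mul2l; apply/orP; right.
  apply: leq_mul; first by rewrite leq_exp2l.
  by rewrite -[l * l]/(l ^ 2) leq_pexp2l.
apply: leq_trans (_ : 2 ^ l.+1 * (2 * M * q) <= _).
  rewrite leq_mul2l; apply/orP; right; apply: leq_trans (ltnW nq) _.
  by rewrite leq_mul2r; apply/orP; right; lia.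
have l4 : l ^ 4 <= 2 ^ (4 * l).
  by rewrite mulnC expnM leq_exp2r // ltnW // ltn_expl.
apply: leq_trans (_ : 2 ^ l.+1 * (2 * M * (2 ^ 56 * 2 ^ (4 * l))) <= _).
  by rewrite /q !leq_mul2l l4 !orbT.
have -> : 2 ^ l.+1 * (2 * M * (2 ^ 56 * 2 ^ (4 * l))) = 2 ^ (l.+1 + 1 + 56 + 4 * l) * M.
  by rewrite !expnD expn1; move: (2 ^ l.+1) (2 ^ 56) (2 ^ (4 * l)) => a b c; lia.
have -> : 8 * (2 ^ (64 * l) * M) = 2 ^ (3 + 64 * l) * M by rewrite expnD mulnA.
by rewrite leq_mul2r leq_exp2l //; apply/orP; right; lia.
Qed.

Theorem theorem1p2 :
  exists C : R, Rlt 0 C /\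
    forall (V : finType) (e : rel V), simple_graph e -> 0 < #|V| ->
    forall n : nat, 3 <= n ->
    Rle (Rmult (Rmult C (INR #|V|)) (pow (ln (INR (chi e))) 4)) (INR n) ->
    is_ramsey_number (cycle_rel n) e ((chi e - 1) * (n - 1) + colour_sigma e).
Proof.
(* Of the exponent 60, 56 is required by [exp2_split]; the remaining factor 16 is the fourth power
   of the 2 in [trunc_log2_ln]. *)
exists (pow 2 60); split; first by apply: pow_lt; lra.
move=> V e [e_sym e_irr] V0 n n3 bign.
have k0 := chi_gt0 e_irr V0.
(* For chromatic number 1 the logarithm vanishes and [n] need not be large compared with [#|V|];
   edgeless graphs are therefore treated directly. *)
have [k1|k1] := leqP (chi e) 1.
  have {}k1 : chi e = 1 by apply/eqP; rewrite eqn_leq k1.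
  split; first exact: ramsey_upper_edgeless.
  by move=> N rN; rewrite k1 mul0n add0n; apply: ramsey_lower_edgeless rN.
have l0 : 0 < trunc_log 2 (chi e) by apply: trunc_log_max.
have lk : 2 ^ trunc_log 2 (chi e) <= #|V|.
  exact: leq_trans (trunc_logP _ k0) (chi_le_card e).
have nat_bign : 2 ^ 56 * (#|V| * trunc_log 2 (chi e) ^ 4) <= n.
  apply: leq_INR; apply: Rle_trans bign.
  rewrite (INR_muln (2 ^ 56)) (INR_muln #|V|) (INR_expn 2) (INR_expn (trunc_log _ _)).
  rewrite (_ : INR 2 = IZR 2) //.
  have := trunc_log2_ln k0; have := pos_INR (trunc_log 2 (chi e)).
  move: (INR (trunc_log 2 _)) (ln _) (INR #|V|) (pos_INR #|V|) => a b c c0 a0 ab.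
  have h : Rle (pow a 4) (Rmult 16 (pow b 4)).
    have -> : Rmult 16 (pow b 4) = pow (Rmult 2 b) 4 by ring.
    by apply: pow_incr.
  have h2 : Rle 0 (Rmult (pow 2 56) c).
    by apply: Rmult_le_pos => //; apply: pow_le; lra.
  have := Rmult_le_compat_l _ _ _ h2 h.
  have -> : pow 2 60 = Rmult (pow 2 56) 16 by rewrite (_ : 60 = 56 + 4)%N // pow_add; congr Rmult; ring.
  by move=> h3; rewrite -Rmult_assoc; apply: Rle_trans h3 _; apply: Req_le; ring.
have Vn : #|V| <= n.
  apply: leq_trans nat_bign; apply: leq_trans (leq_pmulr _ _) (leq_pmull _ _).
    by rewrite expn_gt0 l0.
  by rewrite expn_gt0.
have [M [VM lM bigM bigJ]] := exp2_split l0 lk nat_bign.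
split; last by move=> N; apply: ramsey_lower.
by apply: (@ramsey_upper _ _ e_irr V0 n n3 M (trunc_log 2 (chi e))) => //; apply: trunc_log_ltn.
Qed.
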